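(* Let $d\ge2$ and assume that $\mathbf{E}[Y^\alpha]<\infty$ for some $\alpha>0$. For every $\varepsilon>0$ and $q\ge1$ there exists a finite constant $M=M(\alpha,\varepsilon,q)$ (which may also depend on $d$ and on the distribution of $\tau_e$) such that for every $z\in\mathbf{Z}^d$ and every $x\ge\|z\|$ with $x>0$, $$\mathbf{P}\bigl(T(0,z)-\mu(z)>\varepsilon x\bigr)\le M\,\mathbf{P}(Y>x/M)+\frac{M}{x^q}.$$
   Context: First-passage percolation on the nearest-neighbour lattice $\mathbf{Z}^d$, $d\ge2$, with edge set $\mathcal{E}$. The edge weights $\{\tau_e\}_{e\in\mathcal{E}}$ are nonnegative i.i.d. random variables. For a path $\Gamma$, $T(\Gamma)=\sum_{e\in\Gamma}\tau_e$, and $T(y,z)=\inf\{T(\Gamma):\Gamma\text{ is a path connecting }y\text{ and }z\}$. The time constant is $\mu(z)=\lim_{n\to\infty}T(0,nz)/n$ (limit in probability) for $z\in\mathbf{Z}^d$; it exists as a finite deterministic number without any condition on the weight distribution. $\|\cdot\|$ is the $\ell^1$-norm. $Y$ denotes the minimum of $2d$ independent random variables each distributed as $\tau_e$. *)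

(* Defs.v *)
From HB Require Import structures.
From mathcomp Require Export all_boot all_order all_algebra.
From mathcomp Require Export all_classical all_reals all_analysis.
Export Order.TTheory GRing.Theory Num.Theory.
Export numFieldNormedType.Exports.

Set Implicit Arguments.
Unset Strict Implicit.
Unset Printing Implicit Defensive.

Local Open Scope classical_set_scope.
Local Open Scope ring_scope.

(* The pair (x, i) encodes the unoriented edge {x, x + e_i} of Z^d; every
   nearest-neighbour edge is encoded exactly once. *)
Definition edge (d : nat) : Type := ('rV[int]_d * 'I_d)%type.

Definition edge_src (d : nat) (e : edge d) : 'rV[int]_d := e.1.

Definition edge_dst (d : nat) (e : edge d) : 'rV[int]_d :=
  e.1 + delta_mx 0 e.2.

Definition l1norm (d : nat) (z : 'rV[int]_d) : int := \sum_(i < d) `|z 0 i|.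

(* Edges may be traversed in both directions, and a path may revisit vertices
   and edges; for nonnegative weights this does not affect the infimum in
   [passage_time]. *)
Fixpoint connects (d : nat) (y : 'rV[int]_d) (g : seq (edge d))
    (z : 'rV[int]_d) : bool :=
  if g is e :: g' then
    ((edge_src e == y) && connects (edge_dst e) g' z)
    || ((edge_dst e == y) && connects (edge_src e) g' z)
  else y == z.

Section PassageTime.
Variables (R : realType) (d : nat).

Definition path_time (t : edge d -> R) (g : seq (edge d)) : R :=
  \sum_(e <- g) t e.

Definition passage_time (t : edge d -> R) (y z : 'rV[int]_d) : R :=
  inf [set path_time t g | g in [set g | connects y g z]].

End PassageTime.

Section Probability.
Context (dT : measure_display) (T : measurableType dT) (R : realType).
Variable P : probability T R.

Definition mutually_independent (I : eqType) (X : I -> {RV P >-> R}) : Prop :=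
  forall (J : seq I) (B : I -> set R),
    uniq J -> (forall i, measurable (B i)) ->
    P [set w | forall i, i \in J -> B i (X i w)]
    = (\big[mule/1]_(i <- J) P (X i @^-1` B i))%E.

(* The restriction to measurable sets matters: [distribution P X] is a total
   function on sets, with unspecified values on non-measurable ones. *)
Definition same_distribution (dT' : measure_display) (T' : measurableType dT')
    (Q : probability T' R) (X : {RV P >-> R}) (Y : {RV Q >-> R}) : Prop :=
  forall B : set R, measurable B -> distribution P X B = distribution Q Y B.

Definition is_minimum (I : Type) (X : I -> {RV P >-> R}) (Y : {RV P >-> R})
    : Prop :=
  forall w, (exists i, Y w = X i w) /\ (forall i, Y w <= X i w).

Definition cvg_in_probability (u : nat -> T -> R) (l : R) : Prop :=
  forall eps : R, 0 < eps ->
    (fun n => P [set w | eps < `|u n w - l|]) @ \oo --> 0%E.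

(* [m] is the limit in probability of T(0, n z) / n (the term n = 0 is
   irrelevant); such an [m] is unique. *)
Definition is_time_constant (d : nat) (tau : edge d -> {RV P >-> R})
    (z : 'rV[int]_d) (m : R) : Prop :=
  cvg_in_probability
    (fun n w => passage_time (fun e => tau e w) 0 (z *+ n) / n%:R) m.

End Probability.

(* Main.v *)
(* The edge weights have a polynomial tail, P(tau > s) <= A s^(-beta), because
   the minimum of 2d of them has a moment. To every vertex u attach a random
   hub: among finitely many candidates u + a e_1, the one whose spine (a
   segment in direction e_0) is cheapest. Two neighbouring hubs are joined by
   moving along the first spine, crossing on the cheapest of many disjoint
   translates of a fixed path, and moving back along the second spine; having
   many disjoint candidates and translates gives the hub-to-hub cost as many
   moments as desired. It is moreover a function of finitely many weights, so
   moment bounds for sums of independent variables give deviations of order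
   k^(-p) for sums of k shifted copies of it.

   The weak law T(0, n v) / n -> mu(v), uniform integrability of the hub-to-hub
   times and localisation provide n for which the (finite-range) passage time
   between the hubs of 0 and n v has mean at most n (mu(v) + 1/2). Chaining such
   pieces in the direction v = z div k with k of order x, and covering the
   remaining distance O(k) crudely, reaches the hub of z in time
   mu(z) + eps x / 2 off an event of probability O(x^(-p)). The two end points
   are joined to their hubs through 2d edge-disjoint paths of bounded length,
   which is where the term P(Y > x / M) comes from. *)
From HB Require Import structures.
Require Import Defs.
From mathcomp Require Import ring lra zify.
From mathcomp Require Import measurable_realfun.

Set Implicit Arguments.
Unset Strict Implicit.
Unset Printing Implicit Defensive.

Local Open Scope classical_set_scope.
Local Open Scope ring_scope.

(** * Real-valued probability and moments *)

(** A vertex may be surrounded by 2d slow edges, so T(0, z) need not have more moments than Y and no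
    high moment inequality applies to it directly; hubs confine this effect to the two end points.
    The parameters are tied as follows: the decay exponent is beta = alpha / (2d), an integer p at
    least q fixes the rate, and the number N of candidates satisfies beta N >= 2p + 1, so that a
    minimum over N disjoint paths has a finite moment of order 2p. Such a moment turns k summands
    and a deviation of order k into a probability of order k^(-p).

    The crude gap 1/2 in the mean is harmless: it costs O(k), and k is a small multiple of x.
    Precision comes from the length of the step v, not from a sharp estimate of the mean. As z has
    norm at most x, the steps v stay in a fixed finite box, which makes all constants uniform. Each
    deterministic inequality for mu is read off at a single sample point lying outside finitely many
    rare events. *)

Section RealProbability.
Context (dT : measure_display) (T : measurableType dT) (R : realType).
Variable P : probability T R.
Implicit Types (A B : set T) (f g X Z : T -> R).

(** Real-valued probabilities and expectations keep the estimates within reach of [lra] and [field].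
    The values are meaningful for measurable sets and integrable functions, hence the side
    conditions carried everywhere. *)
Definition Pr A : R := fine (P A).
Definition Ex f : R := \int[P]_w f w.
Definition integ f : Prop := P.-integrable setT (EFin \o f).

Lemma PrE A : measurable A -> P A = (Pr A)%:E.
Proof. by move=> mA; rewrite /Pr fineK// fin_num_measure. Qed.

Lemma Pr_ge0 A : 0 <= Pr A.
Proof. exact: fine_ge0. Qed.

Lemma le_Pr A B : measurable A -> measurable B -> A `<=` B -> Pr A <= Pr B.
Proof.
by move=> mA mB AB; rewrite -lee_fin -!PrE//; apply: le_measure; rewrite ?inE.
Qed.

Lemma PrT : Pr setT = 1.
Proof. by rewrite /Pr probability_setT. Qed.

Lemma Pr0 : Pr set0 = 0.
Proof. by rewrite /Pr measure0. Qed.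

Lemma Pr_le1 A : measurable A -> Pr A <= 1.
Proof. by move=> mA; rewrite -PrT; apply: le_Pr. Qed.

Lemma PrC A : measurable A -> Pr (~` A) = 1 - Pr A.
Proof.
move=> mA; rewrite {1}/Pr probability_setC// PrE//.
Qed.

Lemma PrU A B : measurable A -> measurable B -> Pr (A `|` B) <= Pr A + Pr B.
Proof.
move=> mA mB; rewrite -lee_fin EFinD -!PrE//; last exact: measurableU.
exact: measureU2.
Qed.

Lemma Pr_bigsetU (I : eqType) (s : seq I) (F : I -> set T) :
  (forall i, measurable (F i)) ->
  Pr (\big[setU/set0]_(i <- s) F i) <= \sum_(i <- s) Pr (F i).
Proof.
move=> mF; elim: s => [|i s IH]; first by rewrite !big_nil Pr0.
rewrite !big_cons; apply: le_trans (PrU _ _) _ => //; last by rewrite lerD2l.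
exact: bigsetU_measurable.
Qed.

Lemma integD f g : integ f -> integ g -> integ (fun w => f w + g w).
Proof. by move=> If Ig; apply: (integrableD _ If Ig). Qed.

Lemma integZ c f : integ f -> integ (fun w => c * f w).
Proof. by move=> If; apply: (integrableZl _ _ If). Qed.

Lemma integ_cst c : integ (fun=> c).
Proof. exact: finite_measure_integrable_cst. Qed.

Lemma integ_meas f : integ f -> measurable_fun setT f.
Proof. by move=> /integrableP[/measurable_EFinP]. Qed.

Lemma le_integ f g : measurable_fun setT f -> integ g ->
  (forall w, `|f w| <= g w) -> integ f.
Proof.
move=> mf Ig fg; apply: (le_integrable _ _ _ Ig) => //.
  exact/measurable_EFinP.
by move=> w _ /=; rewrite lee_fin (le_trans (fg w))// ler_norm.
Qed.

Lemma ExD f g : integ f -> integ g ->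
  Ex (fun w => f w + g w) = Ex f + Ex g.
Proof. by move=> If Ig; rewrite /Ex RintegralD. Qed.

Lemma ExZ c f : integ f -> Ex (fun w => c * f w) = c * Ex f.
Proof. by move=> If; rewrite /Ex RintegralZl. Qed.

Lemma Ex_cst c : Ex (fun=> c) = c.
Proof. by rewrite /Ex Rintegral_cst// -/(Pr _) PrT mulr1. Qed.

Lemma le_Ex f g : integ f -> integ g -> (forall w, f w <= g w) -> Ex f <= Ex g.
Proof. by move=> If Ig fg; rewrite /Ex le_Rintegral. Qed.

Lemma Ex_ge0 f : (forall w, 0 <= f w) -> 0 <= Ex f.
Proof. by move=> f0; apply: Rintegral_ge0. Qed.

Lemma eq_Ex f g : f =1 g -> Ex f = Ex g.
Proof. by move=> /funext->. Qed.

Lemma integ_sum (I : Type) (s : seq I) (F : I -> T -> R) :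
  (forall i, integ (F i)) -> integ (fun w => \sum_(i <- s) F i w).
Proof.
move=> IF; elim: s => [|i s IH].
  by under eq_fun do rewrite big_nil; exact: integ_cst.
by under eq_fun do rewrite big_cons; exact: integD.
Qed.

Lemma Ex_sum (I : Type) (s : seq I) (F : I -> T -> R) :
  (forall i, integ (F i)) ->
  Ex (fun w => \sum_(i <- s) F i w) = \sum_(i <- s) Ex (F i).
Proof.
move=> IF; elim: s => [|i s IH].
  by under eq_Ex do rewrite big_nil; rewrite big_nil Ex_cst.
under eq_Ex do rewrite big_cons.
by rewrite big_cons ExD// ?IH//; exact: integ_sum.
Qed.

Lemma measurable_gt f a : measurable_fun setT f ->
  measurable [set w | a < f w].
Proof.
move=> mf; rewrite -[X in measurable X]setTI.
by have := mf measurableT `]a, +oo[%classic (measurable_itv _);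
  rewrite preimage_itvoy.
Qed.

Lemma measurable_ge f a : measurable_fun setT f ->
  measurable [set w | a <= f w].
Proof.
move=> mf; rewrite -[X in measurable X]setTI.
by have := mf measurableT `[a, +oo[%classic (measurable_itv _);
  rewrite preimage_itvcy.
Qed.

Lemma integ_indic A : measurable A -> integ (\1_A : T -> R).
Proof.
move=> mA; apply: (le_integ (g := fun=> 1)); last 2 first.
- exact: integ_cst.
- by move=> w; rewrite indicE; case: (w \in A); rewrite /= ?normr1 ?normr0.
- exact: measurable_indic.
Qed.

Lemma Ex_indic A : measurable A -> Ex (\1_A : T -> R) = Pr A.
Proof.
by move=> mA; rewrite /Ex /Rintegral integral_indic// setIT.
Qed.

Lemma markov_ge f a : integ f -> (forall w, 0 <= f w) ->
  a * Pr [set w | a <= f w] <= Ex f.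
Proof.
move=> If f0.
have mA := measurable_ge a (integ_meas If).
rewrite -Ex_indic// -ExZ; last exact: integ_indic.
apply: le_Ex => //; first by apply: integZ; exact: integ_indic.
move=> w; rewrite indicE; case: (boolP (w \in _)) => [wA|_] /=.
  by rewrite mulr1; move: wA; rewrite inE.
by rewrite mulr0.
Qed.

(** Measurability of f is recorded separately, since it cannot be recovered from that of the n-th
    power of the absolute value. *)
Definition mom (n : nat) f : Prop :=
  measurable_fun setT f /\ integ (fun w => `|f w| ^+ n).

Lemma mom_meas n f : mom n f -> measurable_fun setT f. Proof. by case. Qed.

Lemma normX_le (j n : nat) (x : R) : (j <= n)%N -> `|x| ^+ j <= 1 + `|x| ^+ n.
Proof.
move=> jn; case: (leP `|x| 1) => x1.
  by rewrite (@le_trans _ _ 1)// ?exprn_ile1// lerDl exprn_ge0.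
by rewrite (le_trans (ler_weXn2l (ltW x1) jn))// lerDr.
Qed.

Lemma mom_cst n c : mom n (fun=> c).
Proof. by split; [exact: measurable_cst|exact: integ_cst]. Qed.

Lemma mom_dom n f g : measurable_fun setT f -> mom n g ->
  (forall w, `|f w| <= `|g w|) -> mom n f.
Proof.
move=> mf [mg Ig] fg; split=> //; apply: le_integ Ig _.
  by apply: measurable_funX; exact: measurableT_comp.
by move=> w; rewrite ger0_norm ?exprn_ge0// lerXn2r// nnegrE.
Qed.

Lemma normXD_le (n : nat) (x y : R) :
  `|x + y| ^+ n <= 2 ^+ n * (`|x| ^+ n + `|y| ^+ n).
Proof.
have [xy|yx] := leP `|x| `|y|.
  apply: (@le_trans _ _ ((2 * `|y|) ^+ n)).
    apply: lerXn2r; rewrite ?nnegrE ?mulr_ge0//.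
    by rewrite (le_trans (ler_normD _ _))// mulrDl mul1r lerD2r.
  by rewrite exprMn ler_wpM2l ?exprn_ge0// lerDr exprn_ge0.
apply: (@le_trans _ _ ((2 * `|x|) ^+ n)).
  apply: lerXn2r; rewrite ?nnegrE ?mulr_ge0//.
  by rewrite (le_trans (ler_normD _ _))// mulrDl mul1r lerD2l ltW.
by rewrite exprMn ler_wpM2l ?exprn_ge0// lerDl exprn_ge0.
Qed.

Lemma momD n f g : mom n f -> mom n g -> mom n (fun w => f w + g w).
Proof.
move=> [mf If] [mg Ig]; have mfg := measurable_funD mf mg; split => //.
apply: (le_integ (g := fun w => 2 ^+ n * (`|f w| ^+ n + `|g w| ^+ n))).
- by apply: measurable_funX; exact: measurableT_comp.
- by apply: integZ; exact: integD.
- by move=> w; rewrite ger0_norm ?exprn_ge0// normXD_le.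
Qed.

Lemma mom_sum n (I : Type) (s : seq I) (F : I -> T -> R) :
  (forall i, mom n (F i)) -> mom n (fun w => \sum_(i <- s) F i w).
Proof.
move=> IF; elim: s => [|i s IH].
  by under eq_fun do rewrite big_nil; exact: mom_cst.
by under eq_fun do rewrite big_cons; exact: momD.
Qed.

(** Pointwise, the product is at most the power a + b of the larger absolute value, hence at most 1
    plus its n-th power; no Hölder inequality is involved. *)
Lemma mom_prod n a b f g : mom n f -> mom n g -> (a + b <= n)%N ->
  integ (fun w => f w ^+ a * g w ^+ b).
Proof.
move=> [mf If] [mg Ig] abn.
apply: (le_integ (g := fun w => 1 + (`|f w| ^+ n + `|g w| ^+ n))).
- by apply: measurable_funM; exact: measurable_funX.
- by apply: integD; [exact: integ_cst|exact: integD].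
- move=> w; rewrite normrM !normrX; have [fg|gf] := leP `|f w| `|g w|.
    apply: (@le_trans _ _ (`|g w| ^+ (a + b))).
      by rewrite exprD ler_wpM2r ?exprn_ge0// lerXn2r ?nnegrE.
    by rewrite (le_trans (normX_le _ abn))// lerD2l lerDr exprn_ge0.
  apply: (@le_trans _ _ (`|f w| ^+ (a + b))).
    by rewrite exprD ler_wpM2l ?exprn_ge0// lerXn2r ?nnegrE ?(ltW gf).
  by rewrite (le_trans (normX_le _ abn))// lerD2l lerDl exprn_ge0.
Qed.

Lemma momX n a f : mom n f -> (a <= n)%N -> integ (fun w => f w ^+ a).
Proof.
move=> mf an; have := mom_prod (b := 0) mf mf; move=> /(_ a).
rewrite addn0 => /(_ an).
by under [X in integ X -> _]eq_fun do rewrite expr0 mulr1.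
Qed.

Lemma mom_integ n f : mom n f -> (0 < n)%N -> integ f.
Proof. by move=> mf n0; have := momX mf n0. Qed.

Lemma measurable_preimageT d2 (T2 : measurableType d2) (u : T -> T2) (A : set T2) :
  measurable_fun setT u -> measurable A -> measurable (u @^-1` A).
Proof. by move=> mu mA; have := mu measurableT A mA; rewrite setTI. Qed.

Definition indep2 X Z : Prop := forall A B : set R,
  measurable A -> measurable B ->
  Pr (X @^-1` A `&` Z @^-1` B) = Pr (X @^-1` A) * Pr (Z @^-1` B).

Lemma indep2_comp X Z (u v : R -> R) :
  measurable_fun setT u -> measurable_fun setT v ->
  indep2 X Z -> indep2 (u \o X) (v \o Z).
Proof.
move=> mu mv XZ A B mA mB.
have mA' : measurable (u @^-1` A) by have := mu measurableT A mA; rewrite setTI.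
have mB' : measurable (v @^-1` B) by have := mv measurableT B mB; rewrite setTI.
exact: (XZ _ _ mA' mB').
Qed.

(** The law of (X, Z) agrees with the product of the marginal laws on rectangles, hence everywhere,
    and Fubini then factors the integral of x y. *)
Lemma Ex_indep X Z : indep2 X Z -> integ X -> integ Z ->
  integ (fun w => X w * Z w) -> Ex (fun w => X w * Z w) = Ex X * Ex Z.
Proof.
move=> XZ IX IZ IXZ.
have mX := integ_meas IX; have mZ := integ_meas IZ.
pose X' : {RV P >-> R} := HB.pack X (isMeasurableFun.Build _ _ _ _ X mX).
pose Z' : {RV P >-> R} := HB.pack Z (isMeasurableFun.Build _ _ _ _ Z mZ).
pose h w := (X w, Z w).
have mh : measurable_fun setT h by exact: measurable_fun_pair.
pose h' : {mfun T >-> (R * R)%type} :=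
  HB.pack h (isMeasurableFun.Build _ _ _ _ h mh).
pose m1 := distribution P X'; pose m2 := distribution P Z'.
pose f := fun z : R * R => (z.1 * z.2)%:E.
have mf : measurable_fun setT f.
  by apply/measurable_EFinP; apply: measurable_funM;
    [exact: measurable_fst|exact: measurable_snd].
have eqm (D : set (R * R)) : measurable D ->
    (m1 \x m2)%E D = pushforward P h' D.
  apply: product_measure_unique => B C mB mC.
  change (P (X @^-1` B `&` Z @^-1` C) = P (X @^-1` B) * P (Z @^-1` C))%E.
  have mXB : measurable (X @^-1` B) by exact: measurable_preimageT.
  have mZC : measurable (Z @^-1` C) by exact: measurable_preimageT.
  by rewrite !PrE ?XZ ?EFinM//; exact: measurableI.
have If : (pushforward P h').-integrable setT f.
  by apply: integrable_pushforward.
have E1 : (\int[P]_w (X w * Z w)%:E = \int[pushforward P h']_z f z)%E.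
  by rewrite integral_pushforward.
have E2 : (\int[pushforward P h']_z f z = \int[(m1 \x m2)%E]_z f z)%E.
  by apply: eq_measure_integral => D mD _; exact: (esym (eqm D mD)).
have If2 : (m1 \x m2)%E.-integrable setT f.
  apply/integrableP; split=> //.
  rewrite (eq_measure_integral (pushforward P h')).
    by case/integrableP: If.
  by move=> D mD _; exact: (eqm D mD).
have E3 := integral12_prod_meas1 If2.
have IX1 : m1.-integrable setT (EFin \o idfun).
  by apply: integrable_pushforward => //; apply/measurable_EFinP; exact: measurable_id.
have IZ1 : m2.-integrable setT (EFin \o idfun).
  by apply: integrable_pushforward => //; apply/measurable_EFinP; exact: measurable_id.
have EX1 : (\int[m1]_x x%:E = (Ex X)%:E)%E.
  rewrite integral_pushforward;
    [|exact: mX|exact: EFin_measurable|exact: IX|exact: measurableT].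
  by rewrite preimage_setT /Ex /Rintegral fineK//; exact: (integrable_fin_num _ IX).
have EZ1 : (\int[m2]_x x%:E = (Ex Z)%:E)%E.
  rewrite integral_pushforward;
    [|exact: mZ|exact: EFin_measurable|exact: IZ|exact: measurableT].
  by rewrite preimage_setT /Ex /Rintegral fineK//; exact: (integrable_fin_num _ IZ).
rewrite {1}/Ex /Rintegral E1 E2 -E3 /fubini_F /f /=.
have -> : (\int[m1]_x \int[m2]_y (x * y)%:E = \int[m1]_x ((Ex Z)%:E * x%:E))%E.
  apply: eq_integral => x _; rewrite muleC -EZ1 -integralZl//.
rewrite integralZl// EX1 -EFinM /= mulrC//.
Qed.

End RealProbability.

(** * Moments of sums of centred variables *)

Section MomentBound.
Context (dT : measure_display) (T : measurableType dT) (R : realType).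
Variable P : probability T R.
Implicit Types (xi : nat -> T -> R).

Definition psum xi (k : nat) (w : T) : R := \sum_(i < k) xi i w.

(** Independence is stated between each variable and the partial sum preceding it, which is the form
    in which the binomial expansion of [psum xi k.+1] consumes it. The bound A is common to all
    variables and all orders up to n. *)
Definition centered_family (n : nat) (A : R) xi : Prop :=
  [/\ forall i, mom P n (xi i),
      forall i, Ex P (xi i) = 0,
      forall i b, (b <= n)%N -> `|Ex P (fun w => xi i w ^+ b)| <= A &
      forall k, indep2 P (psum xi k) (xi k)].

Lemma mom_psum n xi k : (forall i, mom P n (xi i)) -> mom P n (psum xi k).
Proof. by move=> mxi; apply: mom_sum => i; exact: mxi. Qed.

Lemma psum_expS n A xi k j : centered_family n A xi -> (j <= n)%N ->
  Ex P (fun w => psum xi k.+1 w ^+ j) =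
  \sum_(b < j.+1) ((Ex P (fun w => psum xi k w ^+ (j - b)) *
                    Ex P (fun w => xi k w ^+ b)) *+ 'C(j, b)).
Proof.
move=> [mxi _ _ ixi] jn.
have mS := mom_psum k mxi.
have I1 (b : 'I_j.+1) : integ P (fun w => psum xi k w ^+ (j - b) * xi k w ^+ b).
  by apply: mom_prod mS (mxi k) _; have := ltn_ord b; lia.
transitivity (Ex P (fun w => \sum_(b < j.+1)
    ('C(j, b)%:R * (psum xi k w ^+ (j - b) * xi k w ^+ b)))).
  apply: eq_Ex => w; rewrite /psum big_ord_recr /= exprDn.
  by apply: eq_bigr => b _; rewrite mulr_natl.
rewrite Ex_sum; last by move=> b; exact/integZ/I1.
apply: eq_bigr => b _; rewrite ExZ// mulr_natl; congr (_ *+ _).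
have bn := ltn_ord b.
have mX c : measurable_fun setT (fun x : R => x ^+ c).
  exact: (measurable_funX _ (@measurable_id _ _ _)).
apply: (@Ex_indep _ _ _ P (fun w => psum xi k w ^+ (j - b))
  (fun w => xi k w ^+ b) _ _ _ (I1 b)).
- exact: (indep2_comp (mX (j - b)%N) (mX b) (ixi k)).
- by apply: momX mS _; lia.
- by apply: momX (mxi k) _; lia.
Qed.

(* The order-1 term of the binomial expansion vanishes, so adding one summand
   changes the j-th moment by at most the order of the (j-2)-th one. *)
Lemma psum_moment (n : nat) (A : R) : 0 <= A -> forall j, (j <= n)%N ->
  exists2 C : R, 0 <= C & forall i, (i <= j)%N ->
    forall xi, centered_family n A xi -> forall k,
      `|Ex P (fun w => psum xi k w ^+ i)| <= C * (k.+1)%:R ^+ i./2.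
Proof.
move=> A0; elim => [|j IH] jn.
  exists 1 => // i; rewrite leqn0 => /eqP-> xi _ k.
  by under eq_Ex do rewrite expr0; rewrite Ex_cst normr1 mulr1.
have [C C0 HC] := IH (ltnW jn).
pose D : R := \sum_(b < j.+2) C * A * 'C(j.+1, b)%:R.
have D0 : 0 <= D by apply: sumr_ge0 => b _; rewrite !mulr_ge0.
suff H : forall xi, centered_family n A xi -> forall k,
      `|Ex P (fun w => psum xi k w ^+ j.+1)| <= D * (k.+1)%:R ^+ (j.+1)./2.
  exists (C + D); first exact: addr_ge0.
  move=> i; rewrite leq_eqVlt => /orP[/eqP->|ij] xi cxi k.
    by rewrite (le_trans (H _ cxi k))// ler_wpM2r ?exprn_ge0// lerDr.
  by rewrite (le_trans (HC i _ _ cxi k))// ler_wpM2r ?exprn_ge0// lerDl.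
move=> xi cxi; have [mxi xi0 Axi _] := cxi.
have [j0|j1] := posnP j.
  move=> k; rewrite j0 /=.
  have -> : Ex P (fun w => psum xi k w ^+ 1) = 0.
    rewrite /psum; under eq_Ex do rewrite expr1.
    rewrite Ex_sum; first by rewrite big1// => i _; exact: xi0.
    by move=> i; exact: mom_integ (mxi i) (leq_trans _ jn).
  by rewrite normr0 mulr1.
have step k : `|Ex P (fun w => psum xi k.+1 w ^+ j.+1)| <=
    `|Ex P (fun w => psum xi k w ^+ j.+1)| + D * (k.+1)%:R ^+ (j.+1)./2.-1.
  rewrite (psum_expS _ cxi)// big_ord_recl /= subn0 bin0 mulr1n.
  have -> : Ex P (fun w => xi k w ^+ 0) = 1.
    by under eq_Ex do rewrite expr0; rewrite Ex_cst.
  rewrite mulr1 (le_trans (ler_normD _ _))// lerD2l.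
  rewrite (le_trans (ler_norm_sum _ _ _))// /D [X in _ <= X * _]big_ord_recl /= bin0 mulr1.
  rewrite mulrDl ler_wpDl// ?mulr_ge0// ?exprn_ge0// mulr_suml.
  apply: ler_sum => b _; rewrite /bump /= add1n.
  have bj := ltn_ord b.
  rewrite normrMn normrM -[leLHS]mulr_natr.
  have [b0|b1] := posnP b.
    rewrite b0; have -> : Ex P (fun w => xi k w ^+ 1) = 0.
      by under eq_Ex do rewrite expr1; exact: xi0.
    by rewrite normr0 !(mulr0, mul0r) !mulr_ge0// exprn_ge0.
  have h2 := Axi k b.+1 ltac:(lia).
  have h1 : `|Ex P (fun w => psum xi k w ^+ (j.+1 - b.+1))| <=
            C * (k.+1)%:R ^+ (j.+1)./2.-1.
    apply: le_trans (HC (j.+1 - b.+1)%N ltac:(lia) _ cxi k) _.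
    by rewrite ler_wpM2l// ler_weXn2l ?ler1n//; lia.
  rewrite [leRHS]mulrAC ler_wpM2r//.
  by rewrite [leRHS]mulrAC ler_pM.
(* Adding up the k increments, each bounded by the last one; the spare factor k then restores the
   full exponent. *)
move=> k; apply: (@le_trans _ _ (D * (k%:R * (k.+1)%:R ^+ (j.+1)./2.-1))).
  elim: k => [|k IHk].
    rewrite mul0r mulr0 /psum; under eq_Ex do rewrite big_ord0 expr0n.
    by rewrite Ex_cst normr0.
  rewrite (le_trans (step k))// -{2}[k.+1]addn1 natrD mulrDl mulrDr mul1r.
  rewrite lerD//.
    apply: (le_trans IHk); rewrite ler_wpM2l// ler_wpM2l//.
    by rewrite lerXn2r ?nnegrE// ler_nat.
  by rewrite ler_wpM2l// lerXn2r ?nnegrE// ler_nat.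
have e : (j.+1)./2 = ((j.+1)./2.-1).+1 by lia.
rewrite ler_wpM2l// [in leRHS]e exprS.
by rewrite ler_wpM2r ?exprn_ge0// ler_nat.
Qed.


End MomentBound.

(** * From tails to moments and back *)

Section TailMoment.
Context (dT : measure_display) (T : measurableType dT) (R : realType).
Variable P : probability T R.
Implicit Types (f : T -> R).

Lemma dyadic_bracket (x : R) : 1 < x ->
  exists k : nat, 2 ^+ k < x /\ x <= 2 ^+ k.+1.
Proof.
move=> x1.
have ex : exists m : nat, x <= 2 ^+ m.
  exists (Num.bound x); apply: (@le_trans _ _ (Num.bound x)%:R).
    by apply/ltW/archi_boundP; rewrite ltW// (lt_trans _ x1).
  by rewrite -natrX ler_nat ltnW// ltn_expl.
have := ex_minnP ex => -[m xm mmin].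
case: m xm mmin => [|m] xm mmin.
  by move: xm; rewrite expr0 leNgt x1.
exists m; split => //; rewrite ltNge; apply/negP => /mmin.
by rewrite ltnn.
Qed.

(** Dyadic decomposition: where 2^k < f <= 2^(k+1) the single term [G k.+1] dominates f^n, and where
    f <= 1 the term [G 0] does. The extra power in the tail makes the expectation of [G k.+1] at
    most A 2^n 2^(-k), which is summable. *)
Lemma mom_of_tail (n : nat) f (A : R) : measurable_fun setT f ->
  (forall w, 0 <= f w) ->
  (forall s, 1 <= s -> Pr P [set w | s < f w] <= A / s ^+ n.+1) -> mom P n f.
Proof.
move=> mf f0 tail; split=> //.
have mfn : measurable_fun setT (fun w => `|f w| ^+ n).
  by apply: measurable_funX; exact: measurableT_comp.
have A0 : 0 <= A.
  by have := le_trans (Pr_ge0 _ _) (tail 1 (lexx _)); rewrite expr1n divr1.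
apply/integrableP; split; first exact/measurable_EFinP.
pose G (k : nat) w : R := if k is k'.+1 then 2 ^+ (n * k) * \1_[set w | 2 ^+ k' < f w] w
  else 1.
have mA k : measurable [set w | 2 ^+ k < f w] by exact: measurable_gt.
have IG k : integ P (G k).
  by case: k => [|k]; [exact: integ_cst|apply/integZ/integ_indic].
have G0 k w : 0 <= G k w.
  by case: k => [|k] //=; rewrite mulr_ge0 ?exprn_ge0// indicE.
have fG w : (`| (`|f w| ^+ n)%:E | <= \sum_(k <oo) (G k w)%:E)%E.
  rewrite gee0_abs ?lee_fin ?exprn_ge0// ger0_norm//.
  have Gge (k : nat) : ((G k w)%:E <= \sum_(k <oo) (G k w)%:E)%E.
    apply: (@le_trans _ _ (\sum_(0 <= i < k.+1) (G i w)%:E)%E).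
      by rewrite big_nat_recr//= leeDr// sume_ge0// => i _; rewrite lee_fin.
    by apply: nneseries_lim_ge => i _ _; rewrite lee_fin.
  have [f1|f1] := leP (f w) 1.
    by apply: le_trans (Gge 0%N); rewrite lee_fin /= exprn_ile1.
  have [k [k1 k2]] := dyadic_bracket f1.
  apply: le_trans (Gge k.+1); rewrite lee_fin /= indicE mem_set// mulr1.
  by rewrite mulnC exprM lerXn2r// nnegrE// exprn_ge0.
pose b (k : nat) : R := if k is k'.+1 then A * 2 ^+ n * 2^-1 ^+ k' else 1.
have b0 k : 0 <= b k.
  by case: k => [|k] //=; rewrite !mulr_ge0// ?exprn_ge0// invr_ge0.
have Gb k : (\int[P]_w (G k w)%:E <= (b k)%:E)%E.
  have -> : (\int[P]_w (G k w)%:E = (Ex P (G k))%:E)%E.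
    by rewrite /Ex /Rintegral fineK//; exact: (integrable_fin_num _ (IG k)).
  rewrite lee_fin; case: k => [|k]; first by rewrite Ex_cst.
  rewrite ExZ ?Ex_indic//; last exact: integ_indic.
  apply: (@le_trans _ _ (2 ^+ (n * k.+1) * (A / (2 ^+ k) ^+ n.+1))).
    apply: ler_wpM2l; first by rewrite exprn_ge0.
    by apply: tail; rewrite exprn_ege1// ler1n.
  rewrite /b exprVn -exprM mulnS mulnS (mulnC k n) addnC exprD [in leLHS](addnC k).
  rewrite [X in _ / X]exprD.
  set u := (2 : R) ^+ (n * k); set v := (2 : R) ^+ k; set z := (2 : R) ^+ n.
  have u0 : u != 0 by rewrite expf_neq0.
  have v0 : v != 0 by rewrite expf_neq0.
  by rewrite le_eqVlt; apply/orP; left; apply/eqP; field; rewrite u0 v0.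
have sb m : \sum_(0 <= k < m) b k <= 1 + 2 * A * 2 ^+ n.
  (* Closed form of the geometric sum, taken up to m + 1 so that the induction starts at the
     exceptional term [b 0]. *)
  suff : \sum_(0 <= k < m.+1) b k <= 1 + A * 2 ^+ n * (2 - 2 * 2^-1 ^+ m).
    rewrite big_nat_recr//= => h.
    apply: le_trans (_ : \sum_(0 <= i < m) b i + b m <= _); first by rewrite lerDl.
    apply: (le_trans h).
    have v0 : 0 <= A * 2 ^+ n * 2^-1 ^+ m.
      by rewrite !mulr_ge0 ?exprn_ge0// invr_ge0.
    by move: v0; set v := _^-1 ^+ m; set u := 2 ^+ n; lra.
  elim: m => [|m IH]; first by rewrite big_nat1 /= expr0 mulr1 subrr mulr0 addr0.
  rewrite big_nat_recr//= (le_trans (lerD IH (lexx _)))//.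
  rewrite exprS; set v := _ ^+ m; lra.
apply: (@le_lt_trans _ _ (\int[P]_w (\sum_(k <oo) (G k w)%:E))%E).
  apply: ge0_le_integral => //=.
  - by apply/measurable_EFinP; exact: measurableT_comp.
  - apply: ge0_emeasurable_sum => k; first by move=> *; rewrite lee_fin.
    by move=> _; exact/measurable_EFinP/(integ_meas (IG k)).
  - by move=> w _; have := fG w.
have -> : (\int[P]_w (\sum_(k <oo) (G k w)%:E) =
    \sum_(k <oo) \int[P]_w (G k w)%:E)%E.
  apply: (@integral_nneseries _ _ _ P setT measurableT (fun k w => (G k w)%:E)).
  - by move=> k; exact/measurable_EFinP/(integ_meas (IG k)).
  - by move=> k w _; rewrite lee_fin.
apply: (@le_lt_trans _ _ (1 + 2 * A * 2 ^+ n)%:E); last exact: ltry.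
apply: lime_le.
  by apply: is_cvg_nneseries => k _ _; apply: integral_ge0 => w _; rewrite lee_fin.
apply: nearW => m; apply: le_trans (_ : (\sum_(0 <= k < m) b k)%:E <= _)%E.
  by rewrite -sumEFin; apply: lee_sum => k _.
by rewrite lee_fin.
Qed.

Lemma markov_moment (p : nat) f (s : R) : 0 < s -> mom P (2 * p) f ->
  Pr P [set w | s < f w] <= Ex P (fun w => f w ^+ (2 * p)) / s ^+ (2 * p).
Proof.
move=> s0 mf; have mf' := mom_meas mf.
rewrite ler_pdivlMr ?exprn_gt0// mulrC.
have I1 : integ P (fun w => f w ^+ (2 * p)) by exact: momX mf _.
apply: le_trans (markov_ge (s ^+ (2 * p)) I1 _); last first.
  by move=> w; rewrite exprM exprn_ge0// sqr_ge0.
rewrite ler_wpM2l ?exprn_ge0 ?(ltW s0)//; apply: le_Pr.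
- exact: measurable_gt.
- exact: measurable_ge (integ_meas I1).
- by move=> w /= sf; rewrite lerXn2r// ?nnegrE; lra.
Qed.

End TailMoment.

(** * Independence and stationarity of local functions *)

Section WeightFields.
Context (R : realType) (d : nat).

(** The carrier of [field_on E] is the space of all configurations, whatever E is; only the
    sigma-algebra varies. Being measurable for it is how [local_on] expresses dependence on the
    weights in E alone, and functions with different supports still take the same argument. *)
Definition cylinders (E : set (edge d)) : set (set (edge d -> R)) :=
  [set A | exists (J : seq (edge d)) (B : edge d -> set R),
     [/\ uniq J, (forall e, e \in J -> E e), (forall e, measurable (B e)) &
         A = [set t | forall e, e \in J -> B e (t e)]]].

Definition field_on (E : set (edge d)) := g_sigma_algebraType (cylinders E).

Definition local_on (E : set (edge d)) (f : (edge d -> R) -> R) : Prop :=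
  measurable_fun [set: field_on E] (f : field_on E -> R).

Lemma cylinders_setI E : setI_closed (cylinders E).
Proof.
move=> A A' [J [B [uJ JE mB ->]]] [J' [B' [uJ' JE' mB' ->]]].
exists (undup (J ++ J')).
exists (fun e => (if e \in J then B e else setT) `&`
                 (if e \in J' then B' e else setT)).
split.
- exact: undup_uniq.
- by move=> e; rewrite mem_undup mem_cat => /orP[/JE|/JE'].
- by move=> e; apply: measurableI; case: ifP.
- apply/seteqP; split=> t /=.
    move=> [h h'] e _; split; case: ifP => // eJ; [exact: h|exact: h'].
  move=> h; split=> e eJ.
    have := h e; rewrite mem_undup mem_cat eJ /= => /(_ isT)[].
    by [].
  by have := h e; rewrite mem_undup mem_cat eJ orbT /= => /(_ isT)[].
Qed.

Lemma local_coord (E : set (edge d)) e : E e -> local_on E (fun t => t e).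
Proof.
move=> Ee _ B mB; rewrite setTI; apply: sub_sigma_algebra.
exists [:: e], (fun=> B); split => //.
- by move=> e'; rewrite inE => /eqP->.
- by apply/seteqP; split=> t /= h; [move=> e'; rewrite inE => /eqP->|apply: h;
    rewrite inE].
Qed.

Lemma measurable_to_field d1 (X : measurableType d1) (E : set (edge d))
    (h : X -> (edge d -> R)) :
  (forall e, E e -> measurable_fun setT (fun x => h x e)) ->
  measurable_fun setT (h : X -> field_on E).
Proof.
move=> mh; apply: (@measurability _ _ X (field_on E) setT h (cylinders E)) => //.
move=> _ [_ [J [B [uJ JE mB ->]]] <-]; rewrite setTI.
have -> : h @^-1` [set t | forall e, e \in J -> B e (t e)] =
    \big[setI/setT]_(e <- J) ((fun x => h x e) @^-1` B e).
  elim: J {uJ JE} => [|e J IH]; first by rewrite big_nil; apply/seteqP.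
  rewrite big_cons -IH; apply/seteqP; split=> x /=.
    move=> H; split; first by apply: H; rewrite inE eqxx.
    by move=> e' e'J; apply: H; rewrite inE e'J orbT.
  by move=> [H1 H2] e'; rewrite inE => /orP[/eqP->|/H2].
elim: J {uJ} JE => [|e J IH] JE; first by rewrite big_nil.
rewrite big_cons; apply: measurableI; last first.
  by apply: IH => e' e'J; apply: JE; rewrite inE e'J orbT.
by apply: measurable_preimageT => //; apply: mh; apply: JE; rewrite inE eqxx.
Qed.

Lemma local_sub (E E' : set (edge d)) f : E `<=` E' -> local_on E f -> local_on E' f.
Proof.
move=> EE' lf.
have mid : measurable_fun setT (idfun : field_on E' -> field_on E).
  by apply: measurable_to_field => e /EE'; exact: local_coord.
exact: (measurableT_comp lf mid).
Qed.

Definition shift (v : 'rV[int]_d) (t : edge d -> R) : edge d -> R :=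
  fun e => t (e.1 + v, e.2).

Definition shift_set (v : 'rV[int]_d) (E : set (edge d)) : set (edge d) :=
  [set e | E (e.1 - v, e.2)].

Lemma local_shift v E f : local_on E f ->
  local_on (shift_set v E) (fun t => f (shift v t)).
Proof.
move=> lf.
have ms : measurable_fun setT (shift v : field_on (shift_set v E) -> field_on E).
  apply: measurable_to_field => e Ee; apply: local_coord => /=.
  by rewrite /shift_set /= addrK -surjective_pairing.
exact: (measurableT_comp lf ms).
Qed.

Lemma shift0 t : shift 0 t = t.
Proof. by apply/funext => -[x i]; rewrite /shift /= addr0. Qed.

Lemma shiftD u v t : shift u (shift v t) = shift (u + v) t.
Proof. by apply/funext => -[x i]; rewrite /shift /= addrA. Qed.

End WeightFields.

Section RandomField.
Context (R : realType) (d : nat).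
Context (dT : measure_display) (T : measurableType dT) (P : probability T R).
Variable tau : edge d -> {RV P >-> R}.
Hypothesis tau_indep : mutually_independent tau.
Hypothesis tau_ident : forall e e', same_distribution (tau e) (tau e').

Definition weights (w : T) : edge d -> R := fun e => tau e w.

Lemma measurable_weights E : measurable_fun setT (weights : T -> field_on R E).
Proof. by apply: measurable_to_field => e _; exact: measurable_funP. Qed.

Lemma measurable_local E f : local_on E f ->
  measurable_fun setT (fun w => f (weights w)).
Proof. by move=> lf; exact: (measurableT_comp lf (@measurable_weights E)). Qed.

Lemma Pr_cylinder (J : seq (edge d)) (B : edge d -> set R) : uniq J ->
  (forall e, measurable (B e)) ->
  Pr P [set w | forall e, e \in J -> B e (tau e w)] =
  \prod_(e <- J) Pr P (tau e @^-1` B e).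
Proof.
move=> uJ mB; rewrite /Pr tau_indep//.
elim: J {uJ} => [|e J IH]; first by rewrite !big_nil.
rewrite !big_cons fineM ?IH//.
  by apply: fin_num_measure; exact: measurable_preimageT.
have : forall K : seq (edge d),
    (\big[mule/1]_(i <- K) P (tau i @^-1` B i))%E \is a fin_num.
  elim=> [|i K IHK]; rewrite ?big_nil ?big_cons// fin_numM//.
  by apply: fin_num_measure; exact: measurable_preimageT.
exact.
Qed.

Let evt (A : set (edge d -> R)) : set T := [set w | A (weights w)].

Lemma measurable_evt E (A : set (edge d -> R)) :
  measurable (A : set (field_on R E)) -> measurable (evt A).
Proof. by move=> mA; exact: (measurable_preimageT (@measurable_weights E) mA). Qed.

(** A pi-lambda argument in one event with the other, D, frozen. It is applied once for each of the
    two events in [indep_sigma], which reduces independence to a pair of cylinders over disjoint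
    edge lists; there the concatenated list gives the product. *)
Lemma indep_induction (E : set (edge d)) (D : set T) : measurable D ->
  (forall A, cylinders E A -> Pr P (evt A `&` D) = Pr P (evt A) * Pr P D) ->
  forall A, measurable (A : set (field_on R E)) ->
    Pr P (evt A `&` D) = Pr P (evt A) * Pr P D.
Proof.
move=> mD cylD A mA.
suff H : (P (evt A `&` D) = P D * P (evt A))%E.
  by rewrite {1}/Pr H fineM ?fin_num_measure//; [rewrite mulrC|exact: measurable_evt mA].
move: A mA.
apply: (@dynkin_induction _ (field_on R E) (cylinders E)
   (fun A => P (evt A `&` D) = P D * P (evt A))%E) => //.
- exact: cylinders_setI.
- have -> : evt [set: edge d -> R] = setT by apply/seteqP; split.
  by rewrite setTI probability_setT mule1.
- move=> A cA; have mA : measurable (A : set (field_on R E)).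
    exact: sub_sigma_algebra.
  have mA' := measurable_evt mA.
  by rewrite !PrE ?cylD// ?EFinM 1?muleC//; exact: measurableI.
- move=> S mS IH.
  have mS' := measurable_evt mS.
  have -> : evt (~` S) = ~` evt S by [].
  rewrite probability_setC// muleBr ?fin_num_measure//.
  rewrite mule1 -IH [in LHS]setIC -setDE measureD//=.
    by rewrite [evt S `&` D]setIC.
  by rewrite ltey_eq fin_num_measure.
- move=> F mF tF IH.
  have mF' n := measurable_evt (mF n).
  have -> : evt (\bigcup_k F k) = \bigcup_k evt (F k) by [].
  have tF' : trivIset setT (fun k => evt (F k)).
    move=> i j _ _ [w [Fi Fj]]; apply: tF => //; by exists (weights w).
  rewrite setI_bigcupl !measure_bigcup//; last 2 first.
  - by move=> i _; exact: measurableI.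
  - exact: trivIset_setIr.
  rewrite (eq_eseriesr (g := fun i => (Pr P D)%:E * P (evt (F i)))%E); last first.
    by move=> i _; rewrite -PrE//; exact: IH.
  by rewrite nneseriesZl// PrE.
Qed.

Lemma indep_sigma (E1 E2 : set (edge d)) (A1 A2 : set (edge d -> R)) :
  (forall e, E1 e -> E2 e -> False) ->
  measurable (A1 : set (field_on R E1)) -> measurable (A2 : set (field_on R E2)) ->
  Pr P (evt A1 `&` evt A2) = Pr P (evt A1) * Pr P (evt A2).
Proof.
move=> E12 mA1 mA2.
apply: (indep_induction (measurable_evt mA2) _ mA1) => {mA1}A1 cA1.
have mA1 : measurable (A1 : set (field_on R E1)) by exact: sub_sigma_algebra.
rewrite setIC [RHS]mulrC.
apply: (indep_induction (measurable_evt mA1) _ mA2) => {mA2}A2 cA2.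
move: cA1 cA2 => [J1 [B1 [uJ1 JE1 mB1 eA1]]] [J2 [B2 [uJ2 JE2 mB2 eA2]]].
have -> : evt A2 `&` evt A1 = [set w | forall e, e \in J2 ++ J1 ->
    (if e \in J2 then B2 e else B1 e) (tau e w)].
  rewrite eA1 eA2; apply/seteqP; split => w /=.
    move=> [h2 h1] e; rewrite mem_cat; case: ifPn => [eJ2 _|_ /=]; first exact: h2.
    exact: h1.
  move=> h; split=> e eJ; have := h e; rewrite mem_cat eJ ?orbT /=.
    exact.
  case: ifPn => [eJ2|_]; last by exact.
  by case: (E12 e); [exact: JE1|exact: JE2].
have d12 e : e \in J1 -> e \notin J2.
  by move=> /JE1 h1; apply/negP => /JE2; exact: E12.
have -> : evt A1 = [set w | forall e, e \in J1 -> B1 e (tau e w)] by rewrite eA1.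
have -> : evt A2 = [set w | forall e, e \in J2 -> B2 e (tau e w)] by rewrite eA2.
rewrite (Pr_cylinder (B := fun e => if e \in J2 then B2 e else B1 e)).
- rewrite !Pr_cylinder// big_cat /=; congr (_ * _); apply: eq_big_seq => e eJ; first by rewrite eJ.
  by rewrite (negbTE (d12 e eJ)).
- rewrite cat_uniq uJ1 uJ2 andbT /=; apply/hasPn => e; exact: d12.
- by move=> e; case: ifP.
Qed.

Lemma indep2_local (E1 E2 : set (edge d)) f g :
  (forall e, E1 e -> E2 e -> False) -> local_on E1 f -> local_on E2 g ->
  indep2 P (fun w => f (weights w)) (fun w => g (weights w)).
Proof.
move=> E12 lf lg A B mA mB.
apply: (indep_sigma (A1 := f @^-1` A) (A2 := g @^-1` B) E12).
- exact: (measurable_preimageT lf mA).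
- exact: (measurable_preimageT lg mB).
Qed.

(** On a cylinder, shifting only renames the edges injectively and the product of identical
    marginals is unchanged; a pi-lambda argument extends this to all events. *)
Lemma Pr_shift v (A : set (edge d -> R)) : measurable (A : set (field_on R setT)) ->
  Pr P [set w | A (shift v (weights w))] = Pr P (evt A).
Proof.
have mev B : measurable (B : set (field_on R setT)) ->
    measurable [set w | B (shift v (weights w))].
  move=> mB.
  have ms : measurable_fun setT (fun w => shift v (weights w) : field_on R setT).
    by apply: measurable_to_field => e _; exact: measurable_funP.
  exact: (measurable_preimageT ms mB).
move=> mA; suff H : P [set w | A (shift v (weights w))] = P (evt A).
  by rewrite /Pr H.
move: A mA.
apply: (@dynkin_induction _ (field_on R setT) (cylinders setT)
   (fun A => P [set w | A (shift v (weights w))] = P (evt A))) => //.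
- exact: cylinders_setI.
- move=> A cA; have mA : measurable (A : set (field_on R setT)).
    exact: sub_sigma_algebra.
  rewrite !PrE; [congr EFin|exact: measurable_evt mA|exact: mev].
  move: cA => [J [B [uJ _ mB eA]]].
  pose sh (e : edge d) : edge d := (e.1 + v, e.2).
  have shI : injective sh.
    by move=> [x i] [y j] [] /addIr -> ->.
  have -> : [set w | A (shift v (weights w))] = [set w | forall e, e \in map sh J ->
      B (e.1 - v, e.2) (tau e w)].
    rewrite eA; apply/seteqP; split=> w /= h e.
      move=> /mapP[e' e'J ->] /=; rewrite addrK -surjective_pairing.
      exact: h e' e'J.
    move=> eJ; have := h (sh e) (map_f sh eJ).
    by rewrite /= addrK -surjective_pairing.
  have -> : evt A = [set w | forall e, e \in J -> B e (tau e w)] by rewrite eA.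
  rewrite (Pr_cylinder (B := fun e => B (e.1 - v, e.2))) ?map_inj_uniq//.
  rewrite Pr_cylinder// big_map.
  apply: eq_bigr => e _; rewrite /= addrK -surjective_pairing.
  by have := tau_ident (sh e) e (mB e); rewrite /distribution /pushforward /Pr => ->.
- move=> S mS IH.
  have mS' := measurable_evt mS; have mS2 := mev _ mS.
  have -> : evt (~` S) = ~` evt S by [].
  have -> : [set w | (~` S) (shift v (weights w))] = ~` [set w | S (shift v (weights w))].
    by [].
  by rewrite !probability_setC// IH.
- move=> F mF tF IH.
  have -> : evt (\bigcup_k F k) = \bigcup_k evt (F k) by [].
  have -> : [set w | (\bigcup_k F k) (shift v (weights w))] =
    \bigcup_k [set w | F k (shift v (weights w))] by [].
  rewrite !measure_bigcup//.
  + by apply: eq_eseriesr => i _; exact: IH.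
  + by move=> i _; exact: measurable_evt (mF i).
  + by move=> i j _ _ [w [Fi Fj]]; apply: tF => //; exists (weights w).
  + by move=> i _; exact: mev.
  + by move=> i j _ _ [w [Fi Fj]]; apply: tF => //; exists (shift v (weights w)).
Qed.

Lemma Pr_local_shift v E f (A : set R) : local_on E f -> measurable A ->
  Pr P [set w | A (f (shift v (weights w)))] = Pr P [set w | A (f (weights w))].
Proof.
move=> lf mA; apply: (Pr_shift v (A := f @^-1` A)).
exact: (measurable_preimageT (local_sub (@subsetT _ E) lf) mA).
Qed.

Lemma measurable_local_shift v E f : local_on E f ->
  measurable_fun setT (fun w => f (shift v (weights w))).
Proof. by move=> lf; exact: (measurable_local (local_shift (v := v) lf)). Qed.

(** Both variables have the same law on the real line, so integrals are compared through that law: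
    first for the absolute value, which gives integrability, then for the signed function. *)
Lemma integ_shift v E f : local_on E f -> integ P (fun w => f (weights w)) ->
  integ P (fun w => f (shift v (weights w))) /\
  Ex P (fun w => f (shift v (weights w))) = Ex P (fun w => f (weights w)).
Proof.
move=> lf If.
have m1 := measurable_local lf; have m2 := measurable_local_shift v lf.
pose X : {RV P >-> R} := HB.pack (fun w => f (weights w)) (isMeasurableFun.Build _ _ _ _ _ m1).
pose Z : {RV P >-> R} := HB.pack (fun w => f (shift v (weights w)))
  (isMeasurableFun.Build _ _ _ _ _ m2).
have eqd A : measurable A -> distribution P Z A = distribution P X A.
  move=> mA; have H := Pr_local_shift v lf mA.
  have mX : measurable [set w | A (f (weights w))] := measurable_preimageT m1 mA.
  have mZ : measurable [set w | A (f (shift v (weights w)))] := measurable_preimageT m2 mA.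
  change (P [set w | A (f (shift v (weights w)))] = P [set w | A (f (weights w))]).
  by rewrite !PrE// H.
have EE g : measurable_fun setT g -> (forall x, 0 <= g x)%E ->
   (\int[P]_w g (f (shift v (weights w))) = \int[P]_w g (f (weights w)))%E.
  move=> mg g0.
  have := ge0_integral_distribution X mg g0.
  have := ge0_integral_distribution Z mg g0.
  rewrite (eq_measure_integral (distribution P X)).
    by move=> -> ->.
  by move=> A mA _; exact: eqd.
have If' := If; move: If => /integrableP[_ Iabs].
have IZ : integ P (fun w => f (shift v (weights w))).
  apply/integrableP; split; first exact/measurable_EFinP.
  by rewrite (EE (fun x => `|x%:E|)%E)//; exact: measurableT_comp.
split => //; rewrite /Ex /Rintegral; congr fine.
have := integral_distribution (X := X) (@EFin_measurable R setT) If'.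
have := integral_distribution (X := Z) (@EFin_measurable R setT) IZ.
rewrite (eq_measure_integral (distribution P X)).
  by move=> /= -> ->.
by move=> A mA _; exact: eqd.
Qed.



End RandomField.

(** * Functions of finitely many weights *)

Section LocalFunctions.
Context (R : realType) (d : nat).
Implicit Types (f g : (edge d -> R) -> R) (E : set (edge d)).

Definition box (r : nat) : set (edge d) :=
  [set e : edge d | forall l : 'I_d, `|e.1 0 l| <= r%:Z].

Definition local_fun f : Prop := exists r, local_on (box r) f.

Lemma box_sub r r' : (r <= r')%N -> box r `<=` box r'.
Proof. by move=> rr' e h l; rewrite (le_trans (h l))// lez_nat. Qed.

Lemma local_on_box r r' f : (r <= r')%N -> local_on (box r) f ->
  local_on (box r') f.
Proof. by move=> /box_sub; exact: local_sub. Qed.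

Lemma local_fun2 f g : local_fun f -> local_fun g ->
  exists r, local_on (box r) f /\ local_on (box r) g.
Proof.
move=> [r lf] [r' lg]; exists (maxn r r').
by split; [apply: local_on_box lf|apply: local_on_box lg];
  rewrite ?leq_maxl ?leq_maxr.
Qed.

Lemma local_fun_cst c : local_fun (fun=> c).
Proof. by exists 0%N; exact: measurable_cst. Qed.

Lemma local_funD f g : local_fun f -> local_fun g -> local_fun (fun t => f t + g t).
Proof.
by move=> lf lg; have [r [lf' lg']] := local_fun2 lf lg; exists r;
  exact: measurable_funD.
Qed.

Lemma local_fun_min f g : local_fun f -> local_fun g ->
  local_fun (fun t => Num.min (f t) (g t)).
Proof.
by move=> lf lg; have [r [lf' lg']] := local_fun2 lf lg; exists r;
  exact: measurable_minr.
Qed.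

Lemma local_fun_sum (I : Type) (s : seq I) (F : I -> (edge d -> R) -> R) :
  (forall i, local_fun (F i)) -> local_fun (fun t => \sum_(i <- s) F i t).
Proof.
move=> lF; elim: s => [|i s IH].
  by under eq_fun do rewrite big_nil; exact: local_fun_cst.
by under eq_fun do rewrite big_cons; exact: local_funD.
Qed.

Lemma norm_coord_bound (v : 'rV[int]_d) : exists r : nat, forall l, `|v 0 l| <= r%:Z.
Proof.
exists (\max_(l < d) `|v 0%R l|)%N => l; rewrite -abszE lez_nat.
by apply: (leq_bigmax (F := fun l => `|v 0%R l|%N)).
Qed.

Lemma local_fun_coord e : local_fun (fun t => t e).
Proof.
by have [r hr] := norm_coord_bound e.1; exists r; exact: local_coord.
Qed.

Lemma local_fun_path (s : seq (edge d)) : local_fun (fun t => path_time t s).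
Proof. by apply: local_fun_sum => e; exact: local_fun_coord. Qed.

Lemma local_fun_shift v f : local_fun f -> local_fun (fun t => f (shift v t)).
Proof.
move=> [r lf]; have [r' hr'] := norm_coord_bound v; exists (r + r')%N.
apply: local_sub (local_shift (v := v) lf) => e; rewrite /shift_set /= => h l.
have := h l; have := hr' l; rewrite /= !mxE.
by move: (e.1 0 l) (v 0 l) => a b; lia.
Qed.

End LocalFunctions.

(** * Deviations of sums of shifted local functions *)

Section Concentration.
Context (R : realType) (d : nat).
Context (dT : measure_display) (T : measurableType dT) (P : probability T R).
Variable tau : edge d -> {RV P >-> R}.
Hypothesis tau_indep : mutually_independent tau.
Hypothesis tau_ident : forall e e', same_distribution (tau e) (tau e').
Local Notation wt := (weights tau).

Lemma mom_shift n v f : local_fun f -> mom P n (fun w => f (wt w)) ->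
  mom P n (fun w => f (shift v (wt w))).
Proof.
move=> [r lf] [mf If]; split; first exact: (measurable_local_shift tau v lf).
have lf' : local_on (box r) (fun t => `|f t| ^+ n).
  by apply: measurable_funX; exact: measurableT_comp.
by have [] := integ_shift tau_indep tau_ident v lf' If.
Qed.

(** Two distinct congruent indices differ by at least K > 2 r, so along a coordinate where v is
    nonzero the centres of the two boxes are more than 2 r apart. *)
Lemma disjoint_boxes (r K i k : nat) (u v : 'rV[int]_d) e :
  v != 0 -> (2 * r < K)%N -> (i < k)%N -> (i %% K = k %% K)%N ->
  shift_set (u + v *+ i) (box r) e -> shift_set (u + v *+ k) (box r) e -> False.
Proof.
move=> v0 rK ik ikK h1 h2.
have [l vl] : exists l, v 0 l != 0.
  apply/existsP; apply: contra_neqT v0; rewrite negb_exists => /forallP h.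
  by apply/rowP => l; rewrite mxE; apply/eqP; have := h l; rewrite negbK.
have := h1 l; have := h2 l; rewrite /= !mxE !mulmxnE.
have Kik : (K <= k - i)%N.
  apply: dvdn_leq; first by rewrite subn_gt0.
  by rewrite -eqn_mod_dvd ?(ltnW ik)//; apply/eqP.
have {}Kik : (i + K <= k)%N by lia.
set a := v 0 l in vl *; set x := e.1 0 l; set y := u 0 l.
rewrite -[a *+ i]mulr_natr -[a *+ k]mulr_natr !natz => hk hi.
have : `|a * (k%:Z - i%:Z)| <= 2 * r%:Z.
  have -> : a * (k%:Z - i%:Z) = (x - (y + a * i)) - (x - (y + a * k)) by ring.
  by apply: le_trans (ler_normB _ _) _; lia.
rewrite normrM => hh.
have a1 : 1 <= `|a| by lia.
have : `|k%:Z - i%:Z| <= `|a| * `|k%:Z - i%:Z| by rewrite ler_peMl.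
lia.
Qed.

(** Copies whose indices are congruent modulo K see disjoint boxes and are independent. The sum is
    split into its K residue classes, the moment bound is applied to each, and if no class exceeds s
    / K then the total stays below s. The constant does not depend on the base point u. *)
Lemma concentration (p : nat) f (v : 'rV[int]_d) : local_fun f -> v != 0 -> (0 < p)%N ->
  mom P (2 * p) (fun w => f (wt w)) ->
  exists2 C : R, 0 <= C & forall u (k : nat) (s : R), 0 < s ->
    Pr P [set w | k%:R * Ex P (fun w => f (wt w)) + s <
                  \sum_(i < k) f (shift (u + v *+ i) (wt w))]
    <= C * (k.+1)%:R ^+ p / s ^+ (2 * p).
Proof.
move=> lf0 v0 p0 mf; have [r lf] := lf0.
set m := Ex P _; pose K := (2 * r).+1.
(* The leading 1 serves the variables replaced by 0 outside a residue class, whose moment of order 0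
   is 1. *)
pose A : R := 1 + \sum_(b < (2 * p).+1) `|Ex P (fun w => (f (wt w) - m) ^+ b)|.
have A1 : 1 <= A by rewrite lerDl sumr_ge0.
have A0 : 0 <= A by rewrite (le_trans _ A1).
have [C C0 HC] := psum_moment P A0 (leqnn (2 * p)).
exists (K%:R * C * K%:R ^+ (2 * p)); first by rewrite !mulr_ge0// exprn_ge0.
move=> u k s s0.
pose F i w := f (shift (u + v *+ i) (wt w)).
(* Padding with zeros keeps the indexing by all i < k, so no reindexing of a residue class is
   needed. *)
pose xi c i w : R := if (i %% K == c)%N then F i w - m else 0.
have mF i : mom P (2 * p) (F i) by exact: mom_shift.
have m1 : integ P (fun w => f (wt w)) by apply: mom_integ mf _; lia.
have EF i : Ex P (F i) = m by have [] := integ_shift tau_indep tau_ident (u + v *+ i) lf m1.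
have mFm i : mom P (2 * p) (fun w => F i w - m) by apply: momD => //; exact: mom_cst.
have mxi c i : mom P (2 * p) (xi c i).
  by rewrite /xi; case: eqP => _; [exact: mFm|exact: mom_cst].
have cent c : centered_family P (2 * p) A (xi c).
  split.
  - exact: mxi.
  - move=> i; rewrite /xi; case: eqP => _; last exact: Ex_cst.
    rewrite ExD ?Ex_cst ?EF ?subrr//; last exact: integ_cst.
    by apply: mom_integ (mF i) _; lia.
  - move=> i b bp; rewrite /xi; case: eqP => _; last first.
      rewrite Ex_cst expr0n; case: eqP => _; rewrite ?normr1 ?normr0//.
    have lg : local_on (box r) (fun t => (f t - m) ^+ b).
      by apply: measurable_funX; apply: measurable_funB => //; exact: measurable_cst.
    have mm : mom P (2 * p) (fun w => f (wt w) - m).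
      by apply: momD => //; exact: mom_cst.
    have [_ ->] := integ_shift tau_indep tau_ident (u + v *+ i) lg (momX mm bp).
    rewrite /A (bigD1 (Ordinal (bp : (b < (2 * p).+1)%N)))//= addrCA lerDl.
    by rewrite addr_ge0// sumr_ge0.
  - move=> j.
    pose E1 : set (edge d) := [set e | exists i, [/\ (i < j)%N, (i %% K = c)%N &
                    shift_set (u + v *+ i) (box r) e]].
    pose E2 : set (edge d) := [set e | (j %% K = c)%N /\ shift_set (u + v *+ j) (box r) e].
    pose phi i t : R := if (i %% K == c)%N then f (shift (u + v *+ i) t) - m else 0.
    have lphi (i : nat) (E : set (edge d)) :
        ((i %% K = c)%N -> shift_set (u + v *+ i) (box r) `<=` E) -> local_on E (phi i).
      move=> iE; rewrite /phi; case: eqP => [ic|_]; last exact: measurable_cst.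
      apply: measurable_funB; last exact: measurable_cst.
      exact: local_sub (iE ic) (local_shift lf).
    apply: (@indep2_local _ _ _ _ _ tau tau_indep E1 E2
      (fun t => \sum_(i < j) phi i t) (phi j)).
    + move=> e [i [ij ic h1]] [jc h2].
      by apply: (disjoint_boxes (K := K) v0 (ltnSn _) ij _ h1 h2); rewrite ic jc.
    + apply: measurable_sum => i; apply: lphi => ic e he.
      by exists i; split.
    + by apply: lphi => jc e he.
have mS c : mom P (2 * p) (psum (xi c) k) by exact: mom_psum.
have sK : 0 < s / K%:R by rewrite divr_gt0.
have sumE w : \sum_(c < K) psum (xi c) k w = \sum_(i < k) F i w - k%:R * m.
  have -> : k%:R * m = \sum_(i < k) m by rewrite sumr_const card_ord mulr_natl.
  rewrite exchange_big /= -sumrB.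
  apply: eq_bigr => i _.
  have iK : (i %% K < K)%N by rewrite ltn_mod.
  rewrite (bigD1 (Ordinal iK))//= big1 ?addr0; first by rewrite /xi eqxx.
  by move=> c cK; rewrite /xi; case: eqP => // ic; move: cK; rewrite -val_eqE /= ic eqxx.
have bound c : Pr P [set w | s / K%:R < psum (xi c) k w] <=
    C * (k.+1)%:R ^+ p / (s / K%:R) ^+ (2 * p).
  apply: le_trans (markov_moment sK (mS c)) _.
  rewrite ler_wpM2r ?invr_ge0 ?exprn_ge0 ?(ltW sK)//.
  apply: le_trans (ler_norm _) _.
  apply: le_trans (HC _ (leqnn _) _ (cent c) k) _.
  by rewrite mul2n doubleK.
have mset c : measurable [set w | s / K%:R < psum (xi c) k w].
  by apply: measurable_gt; have [] := mS c.
apply: (@le_trans _ _ (Pr P (\big[setU/set0]_(c <- index_enum 'I_K)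
    [set w | s / K%:R < psum (xi c) k w]))).
  apply: le_Pr.
  - apply: measurable_gt; apply: measurable_sum => i.
    by have [] := mF i.
  - exact: bigsetU_measurable.
  - move=> w /= sF; rewrite -bigcup_seq.
    apply: contrapT => H.
    have : \sum_(c < K) psum (xi c) k w <= \sum_(c < K) (s / K%:R).
      apply: ler_sum => c _; rewrite leNgt; apply/negP => h; apply: H.
      by exists c => //=; rewrite mem_index_enum.
    rewrite sumE sumr_const card_ord -[_ *+ K]mulr_natr divfK ?pnatr_eq0//.
    by move: sF; rewrite /F; lra.
apply: le_trans (Pr_bigsetU _ _ _) _ => //.
apply: (@le_trans _ _ (\sum_(c < K) C * (k.+1)%:R ^+ p / (s / K%:R) ^+ (2 * p))).
  by apply: ler_sum => c _; exact: bound.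
rewrite sumr_const card_ord -[_ *+ K]mulr_natr exprMn exprVn invfM invrK.
by rewrite le_eqVlt; apply/orP; left; apply/eqP; ring.
Qed.

End Concentration.

(** * Lattice paths and passage times *)

Section Paths.
Context (d : nat).
Implicit Types (x y z v : 'rV[int]_d) (g h : seq (edge d)) (i : 'I_d).

Local Notation unit i := (delta_mx 0 i : 'rV[int]_d).

Definition shift_edge v (e : edge d) : edge d := (e.1 + v, e.2).

Definition line x i (n : nat) : seq (edge d) :=
  [seq (x + unit i *+ k, i) | k <- iota 0 n].

Lemma connects_cat y z x g h : connects y g z -> connects z h x ->
  connects y (g ++ h) x.
Proof.
elim: g y => [|e g IH] y /=; first by move=> /eqP->.
move=> /orP[/andP[-> cg]|/andP[-> cg]] ch; rewrite (IH _ cg ch)//= orbT//.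
Qed.

Lemma connects_edge x i : connects x [:: (x, i)] (x + unit i).
Proof. by rewrite /= /edge_src /edge_dst /= !eqxx. Qed.

Lemma connects_edge_rev x i : connects (x + unit i) [:: (x, i)] x.
Proof. by rewrite /= /edge_src /edge_dst /= !eqxx orbT. Qed.

Lemma connects_rev y g z : connects y g z -> connects z (rev g) y.
Proof.
elim: g y => [|[x i] g IH] y; first by move=> /= /eqP->; rewrite /rev /=.
rewrite rev_cons -cats1 /= => /orP[|] /andP[/eqP <- /IH cg];
  apply: (connects_cat cg).
- exact: connects_edge_rev.
- exact: connects_edge.
Qed.

Lemma connects_shift v y g z : connects y g z ->
  connects (y + v) (map (shift_edge v) g) (z + v).
Proof.
elim: g y => [|[x i] g IH] y /=; first by move=> /eqP->.
rewrite /edge_src /edge_dst /=.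
move=> /orP[/andP[/eqP <- /IH]|/andP[/eqP <- /IH]] cg; apply/orP.
- by left; rewrite eqxx addrAC cg.
- by right; rewrite addrAC eqxx.
Qed.

Lemma line_cat x i m n : line x i (m + n) = line x i m ++ line (x + unit i *+ m) i n.
Proof.
rewrite /line iotaD map_cat add0n -[m in iota m n]addn0 iotaDl -map_comp.
congr (_ ++ _); apply: eq_map => k /=; by rewrite mulrnDr addrA.
Qed.

Lemma connects_line x i n : connects x (line x i n) (x + unit i *+ n).
Proof.
elim: n => [|n IH]; first by rewrite /= mulr0n addr0.
rewrite -addn1 line_cat; apply: (connects_cat IH).
rewrite /line /= mulr0n addr0 mulrnDr mulr1n addrA; exact: connects_edge.
Qed.

Lemma size_line x i n : size (line x i n) = n.
Proof. by rewrite size_map size_iota. Qed.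

(** The corners of the path from x to y that corrects the coordinates one after the other. A [line]
    runs in a positive direction only, hence the two alternatives of [stair_cases]. *)
Definition stair x y (k : nat) : 'rV[int]_d :=
  \row_j (if (j < k)%N then y 0 j else x 0 j).

Lemma stair0 x y : stair x y 0 = x.
Proof. by apply/rowP => j; rewrite mxE. Qed.

Lemma stair_last x y : stair x y d = y.
Proof. by apply/rowP => j; rewrite mxE ltn_ord. Qed.

Lemma stairS x y i : stair x y i.+1 = stair x y i + unit i *~ (y 0 i - x 0 i).
Proof.
apply/rowP => j; rewrite !mxE -scaler_int mxE ltnS leq_eqVlt.
have [ij|ij] := eqVneq (j : nat) i.
  have -> : j = i by apply/val_inj.
  by rewrite ltnn !mxE !eqxx /= mulr1 intz addrC subrK.
have ij' : (j == i) = false by apply/negbTE; rewrite -val_eqE.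
by rewrite !mxE eqxx /= ij' mulr0 addr0.
Qed.

Lemma stair_cases x y i : exists n : nat, n = `|y 0%R i - x 0%R i|%N /\
  (stair x y i.+1 = stair x y i + unit i *+ n \/
   stair x y i = stair x y i.+1 + unit i *+ n).
Proof.
exists `|y 0%R i - x 0%R i|%N; split => //; rewrite stairS.
case: (y 0 i - x 0 i) => n; [left|right].
  by rewrite /= pmulrn.
by rewrite NegzE abszN /= mulrNz -pmulrn subrK.
Qed.

Lemma exists_path x y : exists g, connects x g y.
Proof.
suff H (k : nat) : (k <= d)%N -> exists g, connects x g (stair x y k).
  by have := H d (leqnn d); rewrite stair_last.
elim: k => [|k IH] kd; first by exists [::]; rewrite stair0 /=.
have [g cg] := IH (ltnW kd).
have [n [_ [h|h]]] := stair_cases x y (Ordinal kd).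
  exists (g ++ line (stair x y k) (Ordinal kd) n).
  by apply: (connects_cat cg); rewrite h; exact: connects_line.
exists (g ++ rev (line (stair x y k.+1) (Ordinal kd) n)).
apply: (connects_cat cg); apply: connects_rev.
by have := connects_line (stair x y k.+1) (Ordinal kd) n; rewrite -h.
Qed.

End Paths.

Section PassageTimes.
Context (R : realType) (d : nat).
Implicit Types (x y z v : 'rV[int]_d) (g h : seq (edge d)) (t : edge d -> R).

Lemma path_time_cat t g h : path_time t (g ++ h) = path_time t g + path_time t h.
Proof. exact: big_cat. Qed.

Lemma path_time_rev t g : path_time t (rev g) = path_time t g.
Proof. by rewrite /path_time big_rev. Qed.

Lemma path_time_shift t v g :
  path_time t (map (shift_edge v) g) = path_time (shift v t) g.
Proof. by rewrite /path_time big_map. Qed.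

Lemma path_time_ge0 t g : (forall e, 0 <= t e) -> 0 <= path_time t g.
Proof. by move=> t0; apply: sumr_ge0 => e _. Qed.

Lemma shift_ge0 v t : (forall e, 0 <= t e) -> forall e, 0 <= shift v t e.
Proof. by move=> t0 e; exact: t0. Qed.

Section Nonneg.
Variable t : edge d -> R.
Hypothesis t0 : forall e, 0 <= t e.

Let S x y := [set path_time t g | g in [set g | connects x g y]].

Lemma passage_has_inf x y : has_inf (S x y).
Proof.
split; first by have [g cg] := exists_path x y; exists (path_time t g), g.
by exists 0 => _ [g _ <-]; exact: path_time_ge0.
Qed.

Lemma passage_time_le x y g : connects x g y -> passage_time t x y <= path_time t g.
Proof.
by move=> cg; apply: ge_inf; [exact: (passage_has_inf x y).2|exists g].
Qed.

(** Strict upper bounds on the infimum are witnessed by a single path. This drives measurability,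
    the triangle inequality and the finite-range approximation. *)
Lemma passage_time_ltP x y a :
  passage_time t x y < a <-> exists2 g, connects x g y & path_time t g < a.
Proof.
split=> [H|[g cg]]; last exact/le_lt_trans/passage_time_le.
have [_ [g cg <-] ga] := inf_lt (passage_has_inf x y).1 H.
by exists g.
Qed.

Lemma passage_time_ge0 x y : 0 <= passage_time t x y.
Proof.
apply: lb_le_inf; first exact: (passage_has_inf x y).1.
by move=> _ [g _ <-]; exact: path_time_ge0.
Qed.

Lemma passage_time0 x : passage_time t x x = 0.
Proof.
apply/eqP; rewrite eq_le passage_time_ge0 andbT.
have -> : 0 = path_time t [::] by rewrite /path_time big_nil.
by apply: passage_time_le => /=.
Qed.

Lemma passage_time_le_sym x y : passage_time t x y <= passage_time t y x.
Proof.
apply: lb_le_inf; first exact: (passage_has_inf y x).1.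
by move=> _ [g cg <-]; rewrite -path_time_rev; exact/passage_time_le/connects_rev.
Qed.

Lemma passage_time_sym x y : passage_time t x y = passage_time t y x.
Proof. by apply/eqP; rewrite eq_le !passage_time_le_sym. Qed.

Lemma passage_time_triangle x y z :
  passage_time t x z <= passage_time t x y + passage_time t y z.
Proof.
apply/ler_addgt0Pr => e e0.
have e2 : 0 < e / 2 by rewrite divr_gt0.
have [g cg hg] : exists2 g, connects x g y & path_time t g < passage_time t x y + e / 2.
  by apply/passage_time_ltP; rewrite ltrDl.
have [h ch hh] : exists2 g, connects y g z & path_time t g < passage_time t y z + e / 2.
  by apply/passage_time_ltP; rewrite ltrDl.
apply: le_trans (passage_time_le (connects_cat cg ch)) _.
by rewrite path_time_cat; lra.
Qed.

End Nonneg.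

Lemma passage_time_shift t v x y :
  passage_time (shift v t) x y = passage_time t (x + v) (y + v).
Proof.
rewrite /passage_time; congr inf; apply/seteqP; split=> _ [g cg <-].
  by exists (map (shift_edge v) g); [exact: connects_shift|rewrite path_time_shift].
exists (map (shift_edge (- v)) g).
  by have := connects_shift (- v) cg; rewrite !addrK.
by rewrite path_time_shift shiftD addNr shift0.
Qed.

End PassageTimes.

(** * Minima and minimisers of local functions *)

Section Minima.
Context (R : realType).
Implicit Types (f : nat -> R).

(** The minimum runs over the n + 1 indices 0, ..., n, which is why the number of candidates below
    is N = m + 1 while minima are taken at m. In [argf], ties go to the smaller index. *)
Fixpoint minf f (n : nat) : R :=
  if n is n'.+1 then Num.min (minf f n') (f n) else f 0%N.

Fixpoint argf f (n : nat) : nat :=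
  if n is n'.+1 then (if f (argf f n') <= f n then argf f n' else n) else 0%N.

Lemma argf_le f n : (argf f n <= n)%N.
Proof. by elim: n => [|n IH] //=; case: ifP => _ //; exact: leqW. Qed.

Lemma f_argf f n : f (argf f n) = minf f n.
Proof.
by elim: n => [|n IH] //=; rewrite -IH; case: leP.
Qed.

Lemma lt_minfP f n s : s < minf f n <-> forall j, (j < n.+1)%N -> s < f j.
Proof.
elim: n => [|n IH] /=; first by split=> [h j|]; [rewrite ltnS leqn0 => /eqP->|exact].
rewrite lt_min; split=> [/andP[/IH h1 h2] j|h].
  by rewrite ltnS leq_eqVlt => /orP[/eqP->//|]; exact: h1.
by apply/andP; split; [apply/IH => j jn; apply: h; exact: leqW|exact: h].
Qed.

Lemma minf_ge0 f n : (forall j, 0 <= f j) -> 0 <= minf f n.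
Proof. by move=> f0; rewrite -f_argf. Qed.

Context (d : nat).
Implicit Types (F : nat -> (edge d -> R) -> R).

Lemma local_fun_minf F n : (forall j, local_fun (F j)) ->
  local_fun (fun t => minf (fun j => F j t) n).
Proof.
by move=> lF; elim: n => [|n IH] /=; [exact: lF|exact: local_fun_min].
Qed.

Lemma local_fun_ite (f g h k : (edge d -> R) -> R) :
  local_fun f -> local_fun g -> local_fun h -> local_fun k ->
  local_fun (fun t => if f t <= g t then h t else k t).
Proof.
move=> /local_fun2/[apply] -[r1 [lf lg]] /local_fun2/[apply] -[r2 [lh lk]].
exists (maxn r1 r2).
have := local_on_box (leq_maxl r1 r2) lf; have := local_on_box (leq_maxl r1 r2) lg.
have := local_on_box (leq_maxr r1 r2) lh; have := local_on_box (leq_maxr r1 r2) lk.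
move=> mk mh mg mf; apply: measurable_fun_ifT => //.
exact: measurable_fun_ler.
Qed.

(** Evaluation at a random index stays local, because the minimiser is a nest of finitely many
    comparisons between local functions. *)
Lemma local_fun_argf F G n : (forall j, local_fun (F j)) -> (forall j, local_fun (G j)) ->
  local_fun (fun t => G (argf (fun j => F j t) n) t).
Proof.
move=> lF; elim: n G => [|n IH] G lG /=; first exact: lG.
have -> : (fun t => G (if F (argf (F^~ t) n) t <= F n.+1 t then argf (F^~ t) n else n.+1) t) =
  (fun t => if F (argf (F^~ t) n) t <= F n.+1 t then G (argf (F^~ t) n) t else G n.+1 t).
  by apply/funext => t; case: ifP.
by apply: local_fun_ite => //; exact: IH.
Qed.

End Minima.

(** * Tails of passage times along disjoint paths *)

Section DisjointPaths.
Context (R : realType) (d : nat).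
Context (dT : measure_display) (T : measurableType dT) (P : probability T R).
Variable tau : edge d -> {RV P >-> R}.
Hypothesis tau_ge0 : forall e w, 0 <= tau e w.
Hypothesis tau_indep : mutually_independent tau.
Hypothesis tau_ident : forall e e', same_distribution (tau e) (tau e').
Local Notation wt := (weights tau).

Variable e0 : edge d.
Definition tail (x : R) : R := Pr P [set w | x < tau e0 w].

Lemma tail_ge0 x : 0 <= tail x. Proof. exact: Pr_ge0. Qed.

Lemma measurable_tail_event e x : measurable [set w | x < tau e w].
Proof. exact: measurable_gt. Qed.

Lemma tailE e x : Pr P [set w | x < tau e w] = tail x.
Proof.
have := tau_ident e e0 (measurable_itv (`]x, +oo[ : interval R)).
rewrite /distribution /pushforward /tail /Pr.
by rewrite !preimage_itvoy => ->.
Qed.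

Lemma tail_le x y : x <= y -> tail y <= tail x.
Proof.
by move=> xy; apply: le_Pr; [exact: measurable_tail_event|
  exact: measurable_tail_event|move=> w /=; exact: le_lt_trans].
Qed.

(** The list J collects the slow edges already selected on the paths that have been processed; it
    grows while n decreases in the induction of [Pr_slow]. *)
Definition slow (x : R) (J : seq (edge d)) (gs : nat -> seq (edge d)) (n : nat) : set T :=
  [set w | (forall e, e \in J -> x < tau e w) /\
           (forall j, (j < n)%N -> exists2 e, e \in gs j & x < tau e w)].

Lemma measurable_slow x J gs n : measurable (slow x J gs n).
Proof.
have -> : slow x J gs n =
  (\bigcap_(e in [set` J]) [set w | x < tau e w]) `&`
  (\bigcap_(j in [set j | (j < n)%N]) \bigcup_(e in [set` gs j]) [set w | x < tau e w]).
  apply/seteqP; split => w /=.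
    by move=> [h1 h2]; split.
  by move=> [h1 h2]; split.
apply: measurableI.
  by rewrite bigcap_seq; apply: bigsetI_measurable => e _; exact: measurable_tail_event.
apply: bigcap_measurableType => j _.
by rewrite bigcup_seq; apply: bigsetU_measurable => e _; exact: measurable_tail_event.
Qed.

(* Union bound over the choice of one slow edge per path. *)
Lemma Pr_slow x J gs n l : uniq J ->
  (forall j, (j < n)%N -> (size (gs j) <= l)%N) ->
  (forall j e, (j < n)%N -> e \in J -> e \notin gs j) ->
  (forall j k e, (j < k)%N -> (k < n)%N -> e \in gs j -> e \notin gs k) ->
  Pr P (slow x J gs n) <= tail x ^+ (size J) * (l%:R * tail x) ^+ n.
Proof.
elim: n J => [|n IH] J uJ sz dJ dgs.
  rewrite expr0 mulr1; apply: (@le_trans _ _ (Pr P [set w | forall e, e \in J ->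
      `]x, +oo[%classic (tau e w)])).
    apply: le_Pr; first exact: measurable_slow.
      have := measurable_slow x J gs 0; rewrite /slow.
      set A := [set _ | _]; set B := [set _ | _] => mA.
      suff <- : A = B by [].
      apply/seteqP; split=> w /= h; last first.
        by split => // e eJ; have /= := h e eJ; rewrite in_itv /= andbT.
      by move: h => [h _] e eJ; rewrite /= in_itv /= andbT; exact: h.
    by move=> w [h _] e eJ; rewrite /= in_itv /= andbT; exact: h.
  rewrite (Pr_cylinder tau_indep (B := fun=> `]x, +oo[%classic))//.
  rewrite (eq_bigr (fun=> tail x)); last first.
    by move=> e _; rewrite -(tailE e); rewrite preimage_itvoy.
  by rewrite big_const_seq count_predT iter_mulr_1.
apply: (@le_trans _ _ (\sum_(e <- gs n) Pr P (slow x (e :: J) gs n))).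
  apply: le_trans (Pr_bigsetU _ _ _); last by move=> e; exact: measurable_slow.
  apply: le_Pr; first exact: measurable_slow.
    by apply: bigsetU_measurable => e _; exact: measurable_slow.
  move=> w [h1 h2]; rewrite -bigcup_seq.
  have [e eg ex] := h2 n (ltnSn n); exists e => //; split.
    by move=> e'; rewrite inE => /orP[/eqP->//|/h1].
  by move=> j jn; apply: h2; exact: leqW.
apply: (@le_trans _ _ (\sum_(e <- gs n) tail x ^+ (size J).+1 * (l%:R * tail x) ^+ n)).
  rewrite !big_seq; apply: ler_sum => e eg; apply: IH.
  - by rewrite /= uJ andbT; apply: contraL eg => eJ; exact: dJ.
  - by move=> j jn; apply: sz; exact: leqW.
  - move=> j e' jn; rewrite inE => /orP[/eqP->|eJ]; last by apply: dJ => //; exact: leqW.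
    by apply: contraL eg; exact: dgs.
  - by move=> j k e' jk kn; apply: dgs => //; exact: leqW.
rewrite big_const_seq count_predT iter_addr_0 -[_ *+ size _]mulr_natl.
rewrite !exprS [leRHS](_ : _ = l%:R * (tail x * tail x ^+ size J * (l%:R * tail x) ^+ n)); last by ring.
apply: ler_wpM2r; last by rewrite ler_nat sz.
by rewrite !mulr_ge0 ?exprn_ge0 ?mulr_ge0 ?tail_ge0.
Qed.

Lemma slow_edge (t : edge d -> R) (g : seq (edge d)) (l : nat) s : 0 <= s ->
  (size g <= l)%N -> s < path_time t g -> exists2 e, e \in g & s / l%:R < t e.
Proof.
move=> s0 gl sg; apply: contrapT => H.
have : path_time t g <= \sum_(e <- g) (s / l%:R).
  rewrite /path_time !big_seq; apply: ler_sum => e eg.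
  by rewrite leNgt; apply/negP => h; apply: H; exists e.
rewrite big_const_seq count_predT iter_addr_0 -[_ *+ size _]mulr_natl.
apply/negP; rewrite -ltNge; apply: le_lt_trans sg.
have [l0|l0] := posnP l.
  by rewrite l0 invr0 !mulr0.
by rewrite mulrA ler_pdivrMr ?ltr0n// mulrC ler_wpM2l// ler_nat.
Qed.

Lemma tail_paths (gs : nat -> seq (edge d)) (n l : nat) (s : R) : 0 <= s ->
  (forall j, (j < n)%N -> (size (gs j) <= l)%N) ->
  (forall j k e, (j < k)%N -> (k < n)%N -> e \in gs j -> e \notin gs k) ->
  Pr P [set w | forall j, (j < n)%N -> s < path_time (wt w) (gs j)] <=
  (l%:R * tail (s / l%:R)) ^+ n.
Proof.
move=> s0 sz dgs.
have := @Pr_slow (s / l%:R) [::] gs n l isT sz _ dgs.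
rewrite expr0 mul1r => H; apply: le_trans (H _) => //.
apply: le_Pr; last 2 first.
- exact: measurable_slow.
- move=> w /= h; split=> // j jn; exact: slow_edge (sz j jn) (h j jn).
have -> : [set w | forall j, (j < n)%N -> s < path_time (wt w) (gs j)] =
   \bigcap_(j in [set j | (j < n)%N]) [set w | s < path_time (wt w) (gs j)].
  by apply/seteqP; split.
apply: bigcap_measurableType => j _; apply: measurable_gt.
by apply: measurable_sum => e; exact: measurable_funP.
Qed.

Section Minimum.
Context (dU : measure_display) (U : measurableType dU) (Q : probability U R).
Variables (X : 'I_(2 * d) -> {RV Q >-> R}) (Y : {RV Q >-> R}).
Hypothesis X_indep : mutually_independent X.
Hypothesis X_tau : forall i e, same_distribution (X i) (tau e).
Hypothesis Y_min : is_minimum X Y.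

(** This identity is used in both directions: it turns the moment of Y into a decay of the edge
    tail, and it turns the power 2d of the edge tail, produced by the 2d detours, back into the tail
    of Y. *)
Lemma minimum_tail (s : R) : Pr Q [set u | s < Y u] = tail s ^+ (2 * d).
Proof.
have -> : [set u | s < Y u] =
    [set u | forall i, i \in index_enum 'I_(2 * d) -> `]s, +oo[%classic (X i u)].
  apply/seteqP; split=> u /=.
    move=> sY i _; rewrite /= in_itv /= andbT; apply: (lt_le_trans sY).
    by have [_] := Y_min u.
  move=> h; have [[i ->] _] := Y_min u.
  by have /= := h i; rewrite mem_index_enum in_itv /= andbT => ->.
rewrite /Pr (X_indep (B := fun=> `]s, +oo[%classic)) ?index_enum_uniq//.
rewrite (eq_bigr (fun=> (tail s)%:E)); last first.
  move=> i _; have := X_tau i e0 (measurable_itv (`]s, +oo[ : interval R)).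
  rewrite /distribution /pushforward => ->; rewrite -PrE.
    by rewrite preimage_itvoy.
  exact: measurable_tail_event.
by rewrite prodEFin /= prodr_const card_ord.
Qed.

End Minimum.

End DisjointPaths.

(** * Edge-disjoint detours between neighbours *)

Section Detours.
Context (d : nat) (i0 i1 : 'I_d).
Hypothesis i01 : i0 != i1.
Implicit Types (x y z : 'rV[int]_d) (i : 'I_d) (b : bool).

Local Notation unit i := (delta_mx 0 i : 'rV[int]_d).
Local Notation u0 := (unit i0).
Local Notation u1 := (unit i1).

(* 2d edge-disjoint paths from 0 to u1: the edge itself, the two parallel
   translates through each of the other 2(d-1) neighbours, and a wide loop in the
   plane of u0 and u1 that leaves through - u1 and arrives through u1 *+ 2. *)
Definition detour (k : 'I_d * bool) : seq (edge d) :=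
  let i := k.1 in
  if i != i1 then
    if k.2 then [:: (0, i); (unit i, i1); (u1, i)]
    else [:: (- unit i, i); (- unit i, i1); (u1 - unit i, i)]
  else if k.2 then [:: (0, i1)]
  else [:: (- u1, i1); (- u1, i0); (- u1 + u0, i0); (- u1 + u0 *+ 2, i1);
           (u0 *+ 2, i1); (u1 + u0 *+ 2, i1); (u1 *+ 2 + u0, i0); (u1 *+ 2, i0);
           (u1, i1)].

Lemma size_detour k : (size (detour k) <= 9)%N.
Proof. by rewrite /detour; case: ifP => _; case: ifP. Qed.

Lemma connects_fwd x y z i g : y = x -> connects (x + unit i) g z ->
  connects y ((x, i) :: g) z.
Proof. by move=> -> h; rewrite /= /edge_src /edge_dst /= eqxx h. Qed.

Lemma connects_bwd x y z i g : y = x + unit i -> connects x g z ->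
  connects y ((x, i) :: g) z.
Proof. by move=> -> h; rewrite /= /edge_src /edge_dst /= eqxx h orbT. Qed.

Ltac vec := by apply/rowP => ?; rewrite !(mxE, mulmxnE); ring.

Lemma connects_detour k : connects 0 (detour k) u1.
Proof.
case: k => i b; rewrite /detour /=; case: ifP => ii1; case: b.
- apply: connects_fwd => //; apply: connects_fwd; first by rewrite add0r.
  by apply: connects_bwd => /=; rewrite // addrC.
- apply: connects_bwd; first by rewrite addNr.
  apply: connects_fwd => //; apply: connects_fwd; first by rewrite addrC.
  by rewrite /= subrK.
- by apply: connects_fwd => //; rewrite /= add0r.
- apply: connects_bwd; first by rewrite addNr.
  do 5![apply: connects_fwd; first by vec].
  do 3![apply: connects_bwd; first by vec].
  by rewrite /=.
Qed.

(* Reads off from an edge which detour it lies on; its correctness is what makes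
   the detours edge-disjoint. *)
Definition detour_of (e : edge d) : 'I_d * bool :=
  let: (x, i) := e in
  if i == i1 then
    if [pick j | (j != i1) && (x 0 j == 1)] is Some j then (j, true)
    else if [pick j | (j != i1) && (x 0 j == -1)] is Some j then (j, false)
    else (i1, x == 0)
  else if (0 <= x 0 i1) && (x 0 i1 <= 1) then (i, x 0 i == 0)
  else (i1, false).

Lemma unitE i l : unit i 0 l = (l == i)%:R.
Proof. by rewrite mxE eqxx. Qed.

(** Edges in direction [i1] at offset 1 or -1 in another direction belong to the parallel
    translates. The loop moves two steps in direction [i0] before turning so as to avoid them,
    leaving only the direct edge, with source 0, to be told apart from the loop. *)
Lemma detour_of_i1 x : (forall j, j != i1 -> x 0 j != 1 /\ x 0 j != -1) ->
  detour_of (x, i1) = (i1, x == 0).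
Proof.
move=> h; rewrite /detour_of eqxx; case: pickP => [j /andP[/h[h1 _] h1']|_].
  by rewrite h1' in h1.
case: pickP => [j /andP[/h[_ h1] h1']|_] //.
by rewrite h1' in h1.
Qed.

(** The horizontal edges of the loop lie at heights -1 and 2, outside the heights 0 and 1 at which
    the translates leave and return. *)
Lemma detour_of_i0 x : x 0 i1 = -1 \/ x 0 i1 = 2 -> detour_of (x, i0) = (i1, false).
Proof. by rewrite /detour_of (negbTE i01) => -[|] ->. Qed.

Lemma neq0_coord x l : x 0 l != 0 -> (x == 0) = false.
Proof. by apply: contraNF => /eqP->; rewrite mxE. Qed.

Lemma detour_ofP k e : e \in detour k -> detour_of e = k.
Proof.
have i10 : i1 != i0 by rewrite eq_sym.
case: k => i b; rewrite /detour /=; case: ifP => [ii1|/negbFE/eqP ->]; case: b.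
- have i1i : i1 != i by rewrite eq_sym.
  rewrite !inE => /or3P[] /eqP-> /=.
  + by rewrite (negbTE ii1) !mxE.
  + rewrite eqxx; case: pickP => [j|/(_ i)].
      by rewrite unitE; have [-> //|_] := eqVneq j i; rewrite andbF.
    by rewrite ii1 unitE eqxx.
  + by rewrite (negbTE ii1) !unitE eqxx (negbTE ii1).
- have i1i : i1 != i by rewrite eq_sym.
  rewrite !inE => /or3P[] /eqP-> /=.
  + by rewrite (negbTE ii1) !mxE /= eqxx (negbTE i1i).
  + rewrite eqxx; case: pickP => [j|_].
      by rewrite mxE unitE; case: (j == i); rewrite andbF.
    case: pickP => [j|/(_ i)].
      by rewrite mxE unitE; have [-> //|_] := eqVneq j i; rewrite andbF.
    by rewrite ii1 mxE unitE eqxx.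
  + by rewrite (negbTE ii1) !mxE /= !eqxx (negbTE i1i) (negbTE ii1).
- rewrite inE => /eqP->; rewrite detour_of_i1 ?eqxx//.
  by move=> j _; rewrite mxE.
- have e1 : (i1 == i0) = false by exact/negbTE.
  have e2 : (i0 == i1) = false by exact/negbTE.
  rewrite !inE => /orP[/eqP->|/orP[/eqP->|/orP[/eqP->|/orP[/eqP->|/orP[/eqP->|
    /orP[/eqP->|/orP[/eqP->|/orP[/eqP->|/eqP->]]]]]]]].
  + rewrite detour_of_i1; last by move=> j /negbTE jj; rewrite mxE unitE jj.
    by rewrite (neq0_coord (l := i1))// mxE unitE eqxx.
  + by rewrite detour_of_i0//; left; rewrite mxE unitE eqxx.
  + by rewrite detour_of_i0//; left; rewrite !mxE !eqxx e1.
  + rewrite detour_of_i1.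
      by rewrite (neq0_coord (l := i1))// !(mxE, mulmxnE) !eqxx e1.
    move=> j /negbTE jj; rewrite !(mxE, mulmxnE) jj !eqxx /=.
    by case: (j == i0).
  + rewrite detour_of_i1.
      by rewrite (neq0_coord (l := i0))// !(mxE, mulmxnE) !eqxx.
    move=> j /negbTE jj; rewrite !(mxE, mulmxnE) !eqxx /=.
    by case: (j == i0).
  + rewrite detour_of_i1.
      by rewrite (neq0_coord (l := i1))// !(mxE, mulmxnE) !eqxx e1.
    move=> j /negbTE jj; rewrite !(mxE, mulmxnE) jj !eqxx /=.
    by case: (j == i0).
  + by rewrite detour_of_i0//; right; rewrite !(mxE, mulmxnE) !eqxx e1.
  + by rewrite detour_of_i0//; right; rewrite !(mxE, mulmxnE) !eqxx.
  + rewrite detour_of_i1; last by move=> j /negbTE jj; rewrite unitE jj.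
    by rewrite (neq0_coord (l := i1))// unitE eqxx.
Qed.

End Detours.

(** * Hubs *)

Section Hubs.
Context (R : realType) (d : nat) (i0 i1 : 'I_d).
Hypothesis i01 : i0 != i1.
Variable m : nat.
Implicit Types (x y z u v : 'rV[int]_d) (i : 'I_d) (t : edge d -> R).

Local Notation unit i := (delta_mx 0 i : 'rV[int]_d).
Local Notation u0 := (unit i0).
Local Notation u1 := (unit i1).
Local Notation N := m.+1.

(** The length 2 N leaves room for the N crossing points at distances 2 j, j < N, from the hub. *)
Definition spine (a : nat) : seq (edge d) := line (u1 *+ a) i0 (2 * N).

Definition cost (a : nat) t : R := path_time t (spine a).

Definition hub_cost t : R := minf (cost^~ t) m.

Definition hub_index t : nat := argf (cost^~ t) m.

Definition vertical x (a b : nat) : seq (edge d) :=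
  if (a <= b)%N then line (x + u1 *+ a) i1 (b - a)
  else rev (line (x + u1 *+ b) i1 (a - b)).

Definition link i (a b : nat) : seq (edge d) :=
  (u1 *+ a, i) :: vertical (unit i) a b.

(* The sources of the edges of a link have coordinate 0 or 1 in direction i0, so
   translations by multiples of u0 *+ 2 produce disjoint copies. *)
Definition link_shift i a b (j : nat) : seq (edge d) :=
  map (shift_edge (u0 *+ (2 * j))) (link i a b).

Definition link_cost i a b t : R :=
  minf (fun j => path_time t (link_shift i a b j)) m.

(** The crossing cost is summed over all pairs of possible hub heights instead of being taken at the
    random pair. This only increases it, and makes the bound a sum of minima over fixed families of
    disjoint paths. *)
Definition step_cost i t : R :=
  hub_cost t + hub_cost (shift (unit i) t) +
  \sum_(a < N) \sum_(b < N) link_cost i a b t.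

Definition hub t u : 'rV[int]_d := u + u1 *+ hub_index (shift u t).

Definition hub_time t u v : R := passage_time t (hub t u) (hub t v).

Lemma connects_vertical x a b :
  connects (x + u1 *+ a) (vertical x a b) (x + u1 *+ b).
Proof.
rewrite /vertical; case: leqP => ab.
  have := connects_line (x + u1 *+ a) i1 (b - a).
  by rewrite -addrA -mulrnDr subnKC.
apply: connects_rev; have := connects_line (x + u1 *+ b) i1 (a - b).
by rewrite -addrA -mulrnDr subnKC// ltnW.
Qed.

Lemma connects_link i a b : connects (u1 *+ a) (link i a b) (unit i + u1 *+ b).
Proof.
by apply: connects_fwd => //; rewrite addrC; exact: connects_vertical.
Qed.

Lemma size_link i a b : (a < N)%N -> (b < N)%N -> (size (link i a b) <= N.+1)%N.
Proof.
by move=> aN bN; rewrite /= /vertical; case: ifP => ?; rewrite ?size_rev size_line; lia.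
Qed.

Lemma link_coord i a b e : e \in link i a b -> 0 <= e.1 0 i0 <= 1.
Proof.
have u1i0 : u1 0 i0 = 0 by rewrite unitE (negbTE i01).
rewrite inE => /orP[/eqP->|]; first by rewrite /= mulmxnE u1i0 mul0rn.
have line_coord c n : e \in line (unit i + u1 *+ c) i1 n -> 0 <= e.1 0 i0 <= 1.
  move=> /mapP[k _ ->] /=; rewrite mxE mulmxnE u1i0 mul0rn addr0.
  by rewrite mxE mulmxnE u1i0 mul0rn addr0 unitE; case: (_ == _).
by rewrite /vertical; case: ifP => _; rewrite ?mem_rev; exact: line_coord.
Qed.

Lemma link_shift_disjoint i a b j k e : (j < k)%N ->
  e \in link_shift i a b j -> e \notin link_shift i a b k.
Proof.
move=> jk ej; apply/negP => ek; move: ej ek.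
move=> /mapP[e1 /link_coord + ->] /mapP[e2 /link_coord +] /(congr1 fst) /=.
move=> + + /rowP /(_ i0); rewrite !mxE !mulmxnE unitE eqxx.
by move: (e1.1 0 i0) (e2.1 0 i0) => p q; lia.
Qed.

Lemma spine_disjoint j k e : (j < k)%N -> e \in spine j -> e \notin spine k.
Proof.
move=> jk ej; apply/negP => ek; move: ej ek.
move=> /mapP[a _ ->] /mapP[b _] /(congr1 fst) /= /rowP /(_ i1).
rewrite !mxE !mulmxnE !unitE eqxx eq_sym (negbTE i01) !mul0rn !addr0; lia.
Qed.

Lemma hub_time_shift v t x y :
  hub_time (shift v t) x y = hub_time t (x + v) (y + v).
Proof.
rewrite /hub_time passage_time_shift /hub !shiftD.
by rewrite !(addrAC _ v).
Qed.

Lemma hub_index_lt t : (hub_index t < N)%N.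
Proof. exact: argf_le. Qed.

Section Nonneg.
Variable t : edge d -> R.
Hypothesis t0 : forall e, 0 <= t e.

Lemma spine_prefix (a j : nat) (s : edge d -> R) : (forall e, 0 <= s e) -> (j < N)%N ->
  path_time s (line (u1 *+ a) i0 (2 * j)) <= cost a s.
Proof.
move=> s0 jN; rewrite /cost /spine -(subnKC (_ : 2 * j <= 2 * N)%N); last by lia.
by rewrite line_cat path_time_cat lerDl path_time_ge0.
Qed.

Lemma link_cost_ge0 i a b : 0 <= link_cost i a b t.
Proof. by apply: minf_ge0 => j; exact: path_time_ge0. Qed.

Lemma hub_cost_ge0 (s : edge d -> R) : (forall e, 0 <= s e) -> 0 <= hub_cost s.
Proof. by move=> s0; apply: minf_ge0 => j; exact: path_time_ge0. Qed.

Lemma step_cost_ge0 i : 0 <= step_cost i t.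
Proof.
rewrite !addr_ge0 ?hub_cost_ge0//; first exact: shift_ge0.
by rewrite sumr_ge0// => a _; rewrite sumr_ge0// => b _; exact: link_cost_ge0.
Qed.

Lemma link_passage i a b : (a < N)%N -> (b < N)%N ->
  passage_time t (u1 *+ a) (unit i + u1 *+ b) <=
  cost a t + link_cost i a b t + cost b (shift (unit i) t).
Proof.
move=> aN bN; rewrite /link_cost -f_argf.
set j := argf _ _; have jN : (j < N)%N := argf_le _ _.
have c1 := connects_line (u1 *+ a) i0 (2 * j).
have c2 := connects_shift (u0 *+ (2 * j)) (connects_link i a b).
have c3 : connects (unit i + u1 *+ b + u0 *+ (2 * j))
    (rev (map (shift_edge (unit i)) (line (u1 *+ b) i0 (2 * j)))) (unit i + u1 *+ b).
  apply: connects_rev.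
  have := connects_shift (unit i) (connects_line (u1 *+ b) i0 (2 * j)).
  by rewrite addrAC ![_ + unit i]addrC.
have c := connects_cat (connects_cat c1 c2) c3.
apply: le_trans (passage_time_le t0 c) _.
rewrite !path_time_cat path_time_rev [path_time t (map (shift_edge (unit i)) _)]path_time_shift.
apply: lerD; last by apply: spine_prefix => //; exact: shift_ge0.
by apply: lerD; [exact: spine_prefix|exact: lexx].
Qed.

Lemma hub_step0 i : hub_time t 0 (unit i) <= step_cost i t.
Proof.
rewrite /hub_time /hub add0r shift0.
set a := hub_index t; set b := hub_index _.
have aN : (a < N)%N := hub_index_lt _; have bN : (b < N)%N := hub_index_lt _.
apply: le_trans (link_passage i aN bN) _.
have -> : cost a t = hub_cost t by rewrite /a /hub_index (f_argf (cost^~ t)).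
have -> : cost b (shift (unit i) t) = hub_cost (shift (unit i) t).
  by rewrite /b /hub_index (f_argf (cost^~ (shift (unit i) t))).
rewrite /step_cost addrAC lerD2l.
rewrite (bigD1 (Ordinal aN))//= (bigD1 (Ordinal bN))//= -addrA lerDl.
rewrite addr_ge0// sumr_ge0// => k _; first exact: link_cost_ge0.
by rewrite sumr_ge0// => l _; exact: link_cost_ge0.
Qed.

End Nonneg.

Lemma hub_step t u i : (forall e, 0 <= t e) ->
  hub_time t u (u + unit i) <= step_cost i (shift u t).
Proof.
move=> t0; have := hub_step0 (shift_ge0 u t0) i.
by rewrite hub_time_shift add0r addrC.
Qed.

Lemma local_hub_cost : local_fun hub_cost.
Proof. by apply: local_fun_minf => j; exact: local_fun_path. Qed.

Lemma local_step_cost i : local_fun (step_cost i).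
Proof.
apply: local_funD.
  by apply: local_funD; [|apply: local_fun_shift]; exact: local_hub_cost.
apply: local_fun_sum => a; apply: local_fun_sum => b.
by apply: local_fun_minf => j; exact: local_fun_path.
Qed.

End Hubs.

(** * Comparing passage times with hub times *)

Section HubPaths.
Context (R : realType) (d : nat) (i0 i1 : 'I_d).
Hypothesis i01 : i0 != i1.
Variable m : nat.
Implicit Types (x y z u v : 'rV[int]_d) (i : 'I_d) (t : edge d -> R).

Local Notation unit i := (delta_mx 0 i : 'rV[int]_d).
Local Notation u1 := (unit i1).
Local Notation N := m.+1.
Local Notation htime := (@hub_time R d i0 i1 m).
Local Notation scost := (@step_cost R d i0 i1 m).
Local Notation hubm := (@hub R d i0 i1 m).

Lemma hub_time_triangle t x y z : (forall e, 0 <= t e) ->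
  htime t x z <= htime t x y + htime t y z.
Proof. by move=> t0; exact: passage_time_triangle. Qed.

Lemma hub_time_sym t x y : (forall e, 0 <= t e) -> htime t x y = htime t y x.
Proof. by move=> t0; exact: passage_time_sym. Qed.

Lemma hub_time0 t x : (forall e, 0 <= t e) -> htime t x x = 0.
Proof. by move=> t0; exact: passage_time0. Qed.

Lemma hub_line t u i n : (forall e, 0 <= t e) ->
  htime t u (u + unit i *+ n) <= \sum_(l < n) scost i (shift (u + unit i *+ l) t).
Proof.
move=> t0; elim: n => [|n IH].
  by rewrite mulr0n addr0 hub_time0// big_ord0.
rewrite big_ord_recr /= (le_trans (hub_time_triangle _ (u + unit i *+ n) _ t0))//.
apply: lerD => //; rewrite mulrSr addrA; exact: hub_step.
Qed.

(** The base points y depend on u and v but not on the weights. In each direction the bound is thus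
    a sum of equally spaced shifts of one local function, as [concentration] requires. *)
Lemma hub_path u v : exists y : 'I_d -> 'rV[int]_d, forall t, (forall e, 0 <= t e) ->
  htime t u v <=
  \sum_(i < d) \sum_(l < `|v 0%R i - u 0%R i|%N) scost i (shift (y i + unit i *+ l) t).
Proof.
have ex i : exists y, forall t, (forall e, 0 <= t e) ->
    htime t (stair u v i) (stair u v i.+1) <=
    \sum_(l < `|v 0%R i - u 0%R i|%N) scost i (shift (y + unit i *+ l) t).
  have [n [<- [h|h]]] := stair_cases u v i.
    by exists (stair u v i) => t t0; rewrite h; exact: hub_line.
  exists (stair u v i.+1) => t t0.
  by rewrite hub_time_sym// h; exact: hub_line.
have [y hy] := choice ex; exists y => t t0.
suff H (k : nat) : (k <= d)%N -> htime t u (stair u v k) <=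
    \sum_(i < d | (i < k)%N) \sum_(l < `|v 0%R i - u 0%R i|%N)
       scost i (shift (y i + unit i *+ l) t).
  have := H d (leqnn d); rewrite stair_last.
  by under eq_bigl do rewrite ltn_ord.
elim: k => [|k IH] kd.
  by rewrite stair0 hub_time0// big_pred0.
apply: le_trans (hub_time_triangle _ (stair u v k) _ t0) _.
apply: le_trans (lerD (IH (ltnW kd)) (hy (Ordinal kd) t t0)) _.
rewrite [leRHS](bigD1 (Ordinal kd))//= [leRHS]addrC lerD2r.
rewrite le_eqVlt; apply/orP; left; apply/eqP; apply: eq_bigl => i.
by rewrite -val_eqE /= ltnS [in RHS]leq_eqVlt; case: ltngtP.
Qed.

(** Covers every possible position of the hub of v, so that it does not involve the random index. *)
Definition end_sum t v : R :=
  \sum_(c < N) passage_time t (v + u1 *+ c) (v + u1 *+ c + u1).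

Lemma passage_hub t v : (forall e, 0 <= t e) ->
  passage_time t v (hubm t v) <= end_sum t v.
Proof.
move=> t0; rewrite /hub /end_sum.
have : (hub_index i0 i1 m (shift v t) <= N)%N by exact/ltnW/hub_index_lt.
move: (hub_index _ _ _ _) => a aN; rewrite -(subnKC aN) big_split_ord /=.
apply: ler_wpDr; first by apply: sumr_ge0 => c _; exact: passage_time_ge0.
elim: a {aN} => [|a IH]; first by rewrite big_ord0 mulr0n addr0 passage_time0.
rewrite big_ord_recr /= mulrSr addrA.
by apply: le_trans (passage_time_triangle t0 _ (v + u1 *+ a) _) _; apply: lerD.
Qed.

Lemma passage_le_hub t u v : (forall e, 0 <= t e) ->
  passage_time t u v <= htime t u v + end_sum t u + end_sum t v.
Proof.
move=> t0; have h1 := passage_hub u t0; have h2 := passage_hub v t0.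
rewrite passage_time_sym// in h2.
have := passage_time_triangle t0 u (hubm t u) v.
have := passage_time_triangle t0 (hubm t u) (hubm t v) v.
rewrite /hub_time; lra.
Qed.

Lemma hub_le_passage t u v : (forall e, 0 <= t e) ->
  htime t u v <= passage_time t u v + end_sum t u + end_sum t v.
Proof.
move=> t0; have h1 := passage_hub u t0; have h2 := passage_hub v t0.
rewrite passage_time_sym// in h1.
have := passage_time_triangle t0 (hubm t u) u (hubm t v).
have := passage_time_triangle t0 u v (hubm t v).
rewrite /hub_time; lra.
Qed.

End HubPaths.

(** * Tails at the end points *)

Section HubTails.
Context (R : realType) (d : nat) (i0 i1 : 'I_d).
Hypothesis i01 : i0 != i1.
Context (dT : measure_display) (T : measurableType dT) (P : probability T R).
Variable tau : edge d -> {RV P >-> R}.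
Hypothesis tau_ge0 : forall e w, 0 <= tau e w.
Hypothesis tau_indep : mutually_independent tau.
Hypothesis tau_ident : forall e e', same_distribution (tau e) (tau e').
Local Notation wt := (weights tau).
Variable e0 : edge d.
Variable m : nat.
Local Notation N := m.+1.
Local Notation unit i := (delta_mx 0 i : 'rV[int]_d).
Local Notation u1 := (unit i1).
Local Notation ptail := (tail tau e0).
Local Notation htime := (@hub_time R d i0 i1 m).
Local Notation scost := (@step_cost R d i0 i1 m).
Local Notation esum := (@end_sum R d i1 m).

Lemma wt_ge0 w e : 0 <= wt w e. Proof. exact: tau_ge0. Qed.

(** There are countably many edge lists, and the passage time is below a exactly when one of the
    connecting ones is. *)
Lemma measurable_passage x y : measurable_fun setT (fun w => passage_time (wt w) x y).
Proof.
apply: (measurability _ (RGenInftyO.measurableE R)) => //.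
move=> _ [_ [a ->] <-]; rewrite setTI.
have -> : (fun w => passage_time (wt w) x y) @^-1` `]-oo, a[ =
   \bigcup_(g : seq (edge d)) [set w | connects x g y /\ path_time (wt w) g < a].
  apply/seteqP; split=> w.
    rewrite /= in_itv /= => /(passage_time_ltP (wt_ge0 w)) [g cg ga].
    by exists g.
  move=> [g _ [cg ga]]; rewrite /= in_itv /=.
  by apply/(passage_time_ltP (wt_ge0 w)); exists g.
apply: countable_bigcupT_measurable; first exact: countableP.
move=> g.
case: (boolP (connects x g y)) => cg; last first.
  by rewrite (_ : [set _ | _] = set0)//; apply/seteqP; split=> w // [].
have mg : measurable_fun setT (fun w => path_time (wt w) g).
  by apply: measurable_sum => e; exact: measurable_funP.
have := measurable_preimageT mg (measurable_itv (`]-oo, a[ : interval R)).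
rewrite preimage_itvNyo; congr (measurable _).
by apply/seteqP; split=> w /=; [|case].
Qed.

Lemma neighbor_tail v s : 0 <= s ->
  Pr P [set w | s < passage_time (wt w) v (v + u1)] <=
  (9%:R * ptail (s / 9%:R)) ^+ (2 * d).
Proof.
move=> s0.
(* Enumerates the 2d detours: j < d stands for (j, true) and d <= j < 2d for (j - d, false); the
   default is never reached below 2d. The number 9 is the length of the longest detour. *)
pose gs (j : nat) := map (shift_edge v)
  (if insub j is Some i then detour i0 i1 (i, true)
   else if insub (j - d)%N is Some i then detour i0 i1 (i, false) else [::]).
have gsE j : (j < 2 * d)%N -> exists k : 'I_d * bool,
    gs j = map (shift_edge v) (detour i0 i1 k) /\ j = (if k.2 then k.1 : nat else (d + k.1)%N).
  move=> jd; rewrite /gs; case: insubP => [i ji <-|jd']; first by exists (i, true).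
  case: insubP => [i ji jE|]; last by lia.
  by exists (i, false); split=> //=; rewrite jE; lia.
apply: le_trans (@tail_paths _ _ _ _ _ tau tau_indep tau_ident e0 gs (2 * d) 9 s s0 _ _).
- apply: le_Pr.
  + by apply: measurable_gt; exact: measurable_passage.
  + have -> : [set w | forall j, (j < 2 * d)%N -> s < path_time (wt w) (gs j)] =
      \bigcap_(j in [set j | (j < 2 * d)%N]) [set w | s < path_time (wt w) (gs j)].
      by apply/seteqP; split.
    apply: bigcap_measurableType => j _; apply: measurable_gt.
    by apply: measurable_sum => e; exact: measurable_funP.
  + move=> w /= sT j jd; apply: lt_le_trans sT _.
    have [k [-> _]] := gsE j jd; apply: (passage_time_le (wt_ge0 w)).
    have := connects_shift v (connects_detour i0 i1 k).
    by rewrite add0r addrC.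
- by move=> j /gsE[k [-> _]]; rewrite size_map size_detour.
- move=> j k e jk kd ej; apply/negP => ek.
  have [a [aE ja]] := gsE j (ltn_trans jk kd); have [b [bE kb]] := gsE k kd.
  move: ej ek; rewrite aE bE => /mapP[e1 e1a ->] /mapP[e2 e2b].
  move=> [/addIr e12 e12'].
  have ee : e1 = e2 by rewrite (surjective_pairing e1) (surjective_pairing e2) e12 e12'.
  rewrite -ee in e2b.
  have := detour_ofP i01 e1a; rewrite (detour_ofP i01 e2b) => ab.
  by move: jk; rewrite ja kb ab ltnn.
Qed.

Lemma measurable_end_sum v : measurable_fun setT (fun w => esum (wt w) v).
Proof. by apply: measurable_sum => c; exact: measurable_passage. Qed.

Lemma end_tail v s : 0 <= s ->
  Pr P [set w | s < esum (wt w) v] <=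
  N%:R * (9%:R * ptail (s / (9 * N)%:R)) ^+ (2 * d).
Proof.
move=> s0.
have sN : 0 <= s / N%:R by rewrite divr_ge0.
pose F (c : 'I_N) := [set w | s / N%:R <
   passage_time (wt w) (v + u1 *+ c) (v + u1 *+ c + u1)].
have mF c : measurable (F c) by apply: measurable_gt; exact: measurable_passage.
apply: (@le_trans _ _ (Pr P (\big[setU/set0]_(c <- index_enum 'I_N) F c))).
  apply: le_Pr; first exact/measurable_gt/measurable_end_sum.
    exact: bigsetU_measurable.
  move=> w /= sE; rewrite -bigcup_seq; apply: contrapT => H.
  have : esum (wt w) v <= \sum_(c < N) (s / N%:R).
    apply: ler_sum => c _; rewrite leNgt; apply/negP => h; apply: H.
    by exists c => //=; rewrite mem_index_enum.
  rewrite sumr_const card_ord -[_ *+ N]mulr_natr divfK ?pnatr_eq0//.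
  by rewrite leNgt sE.
apply: le_trans (Pr_bigsetU _ _ _) _ => //.
rewrite mulr_natl -[X in _ *+ X]card_ord -sumr_const; apply: ler_sum => c _.
by rewrite natrM invfM mulrA mulrAC; exact: neighbor_tail.
Qed.

End HubTails.

(** * Moments of the step costs *)

Section HubMoments.
Context (R : realType) (d : nat) (i0 i1 : 'I_d).
Hypothesis i01 : i0 != i1.
Context (dT : measure_display) (T : measurableType dT) (P : probability T R).
Variable tau : edge d -> {RV P >-> R}.
Hypothesis tau_ge0 : forall e w, 0 <= tau e w.
Hypothesis tau_indep : mutually_independent tau.
Hypothesis tau_ident : forall e e', same_distribution (tau e) (tau e').
Local Notation wt := (weights tau).
Variable e0 : edge d.
Variables m p : nat.
Hypothesis p_gt0 : (0 < p)%N.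
Local Notation N := m.+1.
Local Notation unit i := (delta_mx 0 i : 'rV[int]_d).
Local Notation ptail := (tail tau e0).
Local Notation htime := (@hub_time R d i0 i1 m).
Local Notation scost := (@step_cost R d i0 i1 m).
Variables A beta : R.
Hypothesis tail_decay : forall s : R, 0 < s -> ptail s <= A * s `^ (- beta).
Hypothesis m_large : (2 * p).+1%:R <= beta * N%:R.

(** The N-th power decays like s^(-beta N), and [m_large] makes this at most s^(-(2p + 1)) for s >=
    1: one power beyond 2p, as [mom_of_tail] demands. *)
Lemma tail_power (l : nat) : (0 < l)%N -> exists A' : R, forall s : R, 1 <= s ->
  (l%:R * ptail (s / l%:R)) ^+ N <= A' / s ^+ (2 * p).+1.
Proof.
move=> l0; have l0' : 0 < l%:R :> R by rewrite ltr0n.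
exists ((l%:R * A * l%:R `^ beta) ^+ N) => s s1.
have s0 : 0 < s by rewrite (lt_le_trans _ s1).
have h : ptail (s / l%:R) <= A * (l%:R `^ beta * s `^ (- beta)).
  apply: le_trans (tail_decay _) _; first by rewrite divr_gt0.
  have -> : (s / l%:R) `^ (- beta) = l%:R `^ beta * s `^ (- beta).
    rewrite powRM ?invr_ge0 ?(ltW s0)// mulrC; congr (_ * _).
    by rewrite -powR_inv1 ?ler0n// -powRrM mulN1r opprK.
  by [].
apply: (@le_trans _ _ ((l%:R * A * l%:R `^ beta * s `^ (- beta)) ^+ N)).
  rewrite lerXn2r ?nnegrE//.
  - by rewrite mulr_ge0 ?tail_ge0.
  - by rewrite -!mulrA mulr_ge0// (le_trans _ h)// tail_ge0.
  - by rewrite -!mulrA ler_wpM2l.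
rewrite exprMn ler_wpM2l//.
  apply: exprn_ge0; rewrite -mulrA mulr_ge0//.
  have := le_trans (tail_ge0 _ _ _) h; rewrite mulrA pmulr_lge0//.
  by rewrite powR_gt0.
rewrite -[leLHS]powR_mulrn ?powR_ge0// -powRrM mulNr powRN lef_pV2 ?posrE ?powR_gt0 ?exprn_gt0//.
by rewrite -powR_mulrn ?(ltW s0)// ler_powR.
Qed.

Lemma mom_minf (F : nat -> (edge d -> R) -> R) (l : nat) (gs : nat -> seq (edge d)) :
  (0 < l)%N -> (forall j t, F j t = path_time t (gs j)) ->
  (forall j, (j < N)%N -> (size (gs j) <= l)%N) ->
  (forall j k e, (j < k)%N -> (k < N)%N -> e \in gs j -> e \notin gs k) ->
  mom P (2 * p) (fun w => minf (fun j => F j (wt w)) m).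
Proof.
move=> l0 FE sz dis.
have [A' hA'] := tail_power l0.
have lF j : local_fun (F j) by rewrite (funext (FE j)); exact: local_fun_path.
have [r lm] := local_fun_minf m lF.
have mm : measurable_fun setT (fun w => minf (fun j => F j (wt w)) m).
  exact: (measurable_local tau lm).
apply: (mom_of_tail (A := A')) => //.
  by move=> w; apply: minf_ge0 => j; rewrite FE path_time_ge0// => e; exact: tau_ge0.
move=> s s1; apply: le_trans (hA' s s1).
apply: le_trans (tail_paths tau_indep tau_ident e0 _ sz dis); last by rewrite (le_trans _ s1).
apply: le_Pr.
- exact: measurable_gt.
- have -> : [set w | forall j, (j < N)%N -> s < path_time (wt w) (gs j)] =
    \bigcap_(j in [set j | (j < N)%N]) [set w | s < path_time (wt w) (gs j)].
    by apply/seteqP; split.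
  apply: bigcap_measurableType => j _; apply: measurable_gt.
  by apply: measurable_sum => e; exact: measurable_funP.
- move=> w /= /lt_minfP h j jN; have := h j jN; by rewrite FE.
Qed.

Lemma mom_step_cost i : mom P (2 * p) (fun w => scost i (wt w)).
Proof.
have mh : mom P (2 * p) (fun w => hub_cost i0 i1 m (wt w)).
  apply: (@mom_minf (cost i0 i1 m) (2 * N) (fun a => spine i0 i1 m a)) => //.
  - by move=> j _; rewrite /spine size_line.
  - by move=> j k e jk _; exact: spine_disjoint.
apply: momD.
  apply: momD => //.
  by apply: (mom_shift tau_indep tau_ident (unit i) (local_hub_cost R i0 i1 m) mh).
apply: mom_sum => a; apply: mom_sum => b.
apply: (@mom_minf (fun j t => path_time t (link_shift i0 i1 i a b j)) N.+1
  (link_shift i0 i1 i a b)) => //.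
- by move=> j _; rewrite size_map; exact: (size_link i01 i (ltn_ord a) (ltn_ord b)).
- by move=> j k e jk _; exact: link_shift_disjoint.
Qed.

(** Concentration along each direction of a lattice path, with deviation J. As a direction has at
    most J steps, (n i + 1)^p / J^(2p) is at most 2^p / J^p. The actual distance may be much smaller
    than J; enlarging J buys probability at the price of a weaker bound. *)
Lemma crude_hub : exists C A' : R, [/\ 0 < C, 0 <= A' &
  forall (J : nat) (u v : 'rV[int]_d), (0 < J)%N -> (forall l, `|v 0 l - u 0 l| <= J%:Z) ->
    exists B, [/\ measurable B, Pr P B <= A' / J%:R ^+ p &
      forall w, ~ B w -> htime (wt w) u v <= C * J%:R]].
Proof.
have ex i : exists C : R, 0 <= C /\ forall u (k : nat) (s : R), 0 < s ->
    Pr P [set w | k%:R * Ex P (fun w => scost i (wt w)) + s <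
                  \sum_(l < k) scost i (shift (u + unit i *+ l) (wt w))]
    <= C * (k.+1)%:R ^+ p / s ^+ (2 * p).
  have v0 : unit i != 0.
    by apply/negP => /eqP/rowP/(_ i); rewrite unitE mxE eqxx.
  have [C C0 hC] := concentration tau_indep tau_ident (local_step_cost R i0 i1 m i) v0
    p_gt0 (mom_step_cost i).
  by exists C.
have [C hC] := choice ex.
pose me i := Ex P (fun w => scost i (wt w)).
have me0 i : 0 <= me i.
  by apply: Ex_ge0 => w; apply: step_cost_ge0 => e; exact: tau_ge0.
exists (1 + \sum_i (me i + 1)), (\sum_i C i * 2 ^+ p); split.
- by rewrite ltr_pwDl// sumr_ge0// => i _; rewrite addr_ge0.
- by apply: sumr_ge0 => i _; rewrite mulr_ge0 ?exprn_ge0//; have [] := hC i.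
move=> J u v J0 uvJ.
have J0' : 0 < J%:R :> R by rewrite ltr0n.
have [y hy] := @hub_path R d i0 i1 i01 m u v.
pose n (i : 'I_d) := `|v 0%R i - u 0%R i|%N.
have nJ i : (n i <= J)%N by have := uvJ i; rewrite /n; lia.
pose F (i : 'I_d) := [set w | (n i)%:R * me i + J%:R <
  \sum_(l < n i) scost i (shift (y i + unit i *+ l) (wt w))].
have mF i : measurable (F i).
  apply: measurable_gt; apply: measurable_sum => l.
  have [r lr] := local_step_cost R i0 i1 m i.
  exact: (measurable_local_shift tau _ lr).
exists (\big[setU/set0]_(i <- index_enum 'I_d) F i); split.
- exact: bigsetU_measurable.
- apply: le_trans (Pr_bigsetU _ _ _) _ => //.
  rewrite mulr_suml; apply: ler_sum => i _.
  have [C0 /(_ (y i) (n i) J%:R J0') h] := hC i; apply: le_trans h _.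
  rewrite -!mulrA ler_wpM2l// mul2n -addnn exprD invfM mulrA ler_wpM2r ?invr_ge0 ?exprn_ge0//.
  rewrite ler_pdivrMr ?exprn_gt0// -exprMn lerXn2r ?nnegrE ?mulr_ge0//.
  by rewrite -natrM ler_nat; have := nJ i; lia.
- move=> w nB; apply: le_trans (hy _ _) _; first by move=> e; exact: tau_ge0.
  rewrite mulrDl mul1r ler_wpDl ?(ltW J0')// mulr_suml; apply: ler_sum => i _.
  have : ~ F i w.
    by move=> Fi; apply: nB; rewrite -bigcup_seq; exists i => //=; rewrite mem_index_enum.
  move=> /negP; rewrite -leNgt => h; apply: le_trans h _.
  by rewrite mulrDl mul1r lerD2r mulrC ler_wpM2l// ler_nat.
Qed.

End HubMoments.

(** * The time constant *)

Section EventuallySmall.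
Context (dT : measure_display) (T : measurableType dT) (R : realType).
Variable P : probability T R.

Definition eventually_small (F : nat -> set T) : Prop :=
  forall delta : R, 0 < delta -> exists n0 : nat, forall n, (n0 <= n)%N ->
    measurable (F n) /\ Pr P (F n) <= delta.

Lemma eventually_smallU F G : eventually_small F -> eventually_small G ->
  eventually_small (fun n => F n `|` G n).
Proof.
move=> hF hG e e0; have e2 : 0 < e / 2 by rewrite divr_gt0.
have [n1 h1] := hF _ e2; have [n2 h2] := hG _ e2.
exists (maxn n1 n2) => n; rewrite geq_max => /andP[/h1[mF eF] /h2[mG eG]].
split; first exact: measurableU.
by apply: le_trans (PrU _ mF mG) _; rewrite [leRHS](splitr e) lerD.
Qed.

(** Supplies the sample point at which an inequality between random times becomes one between time
    constants. *)
Lemma eventually_small_outside F n0 : eventually_small F ->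
  exists n w, (n0 <= n)%N /\ ~ F n w.
Proof.
move=> hF; have h2 : (0 : R) < 2^-1 by rewrite invr_gt0.
have [n1 h1] := hF _ h2.
have [mF eF] := h1 (maxn n0 n1) (leq_maxr _ _).
exists (maxn n0 n1); apply: contrapT => H.
have FT : F (maxn n0 n1) = setT.
  apply/seteqP; split=> // w _; apply: contrapT => nF; apply: H.
  by exists w; split => //; exact: leq_maxl.
move: eF; rewrite FT PrT; lra.
Qed.

End EventuallySmall.

Section TimeConstant.
Context (R : realType) (d : nat) (i0 i1 : 'I_d).
Hypothesis i01 : i0 != i1.
Context (dT : measure_display) (T : measurableType dT) (P : probability T R).
Variable tau : edge d -> {RV P >-> R}.
Hypothesis tau_ge0 : forall e w, 0 <= tau e w.
Hypothesis tau_indep : mutually_independent tau.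
Hypothesis tau_ident : forall e e', same_distribution (tau e) (tau e').
Local Notation wt := (weights tau).
Variable mu : 'rV[int]_d -> R.
Hypothesis mu_time_constant : forall z, is_time_constant tau z (mu z).
Variable e0 : edge d.
Variables m p : nat.
Hypothesis p_gt0 : (0 < p)%N.
Local Notation N := m.+1.
Local Notation ptail := (tail tau e0).
Local Notation htime := (@hub_time R d i0 i1 m).
Local Notation esum := (@end_sum R d i1 m).
Variables A beta : R.
Hypothesis beta_gt0 : 0 < beta.
Hypothesis tail_decay : forall s : R, 0 < s -> ptail s <= A * s `^ (- beta).
Hypothesis m_large : (2 * p).+1%:R <= beta * N%:R.

Lemma tail_small (eta : R) : 0 < eta ->
  exists2 s0 : R, 0 < s0 & forall s, s0 <= s -> ptail s <= eta.
Proof.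
move=> eta0; pose c := `|A| / eta + 1.
have c0 : 0 < c by rewrite ltr_pwDr// divr_ge0// ltW.
exists (c `^ beta^-1); first exact: powR_gt0.
move=> s cs; have s0 : 0 < s by apply: lt_le_trans cs; exact: powR_gt0.
have csb : c <= s `^ beta.
  have := @ge0_ler_powR R beta (ltW beta_gt0) (c `^ beta^-1) s.
  rewrite !nnegrE powR_ge0 ltW// => /(_ isT isT cs).
  by rewrite -powRrM mulVf ?gt_eqF// powRr1// ltW.
have sb0 : 0 < s `^ beta by exact: powR_gt0.
apply: le_trans (tail_decay s0) _; rewrite powRN ler_pdivrMr//.
apply: (@le_trans _ _ (eta * c)); last by rewrite ler_wpM2l// ltW.
by rewrite /c mulrDr mulr1 mulrC divfK ?gt_eqF// (le_trans (ler_norm _))// lerDl ltW.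
Qed.

Lemma end_small (delta : R) : 0 < delta -> exists2 s0 : R, 0 < s0 &
  forall s v, s0 <= s -> Pr P [set w | s < esum (wt w) v] <= delta.
Proof.
(* The first bound makes 9 times the tail at most 1, so its power 2d may be replaced by the first
   power; the second brings the union over N heights down to delta. *)
move=> delta0; pose eta := Num.min (9^-1) (delta / (9 * N%:R)).
have eta0 : 0 < eta by rewrite lt_min invr_gt0 ltr0n /= divr_gt0.
have [s0 s00 hs0] := tail_small eta0.
exists (s0 * (9 * N)%:R); first by rewrite mulr_gt0.
move=> s v ss; have s_ge0 : 0 <= s by apply: le_trans ss; rewrite mulr_ge0 ?(ltW s00).
apply: le_trans (end_tail i01 tau_ge0 tau_indep tau_ident e0 m v s_ge0) _.
have h : ptail (s / (9 * N)%:R) <= eta by apply: hs0; rewrite ler_pdivlMr.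
have h9 : 9 * ptail (s / (9 * N)%:R) <= 1.
  by rewrite -ler_pdivlMl// mulr1 (le_trans h)// /eta ge_min lexx.
have d0 : (0 < 2 * d)%N by rewrite muln_gt0 /= (leq_ltn_trans _ (ltn_ord i0)).
apply: (@le_trans _ _ (N%:R * (9 * ptail (s / (9 * N)%:R)))).
  rewrite ler_wpM2l// -(prednK d0) exprS ler_piMr ?mulr_ge0 ?tail_ge0//.
  by rewrite exprn_ile1// mulr_ge0// tail_ge0.
apply: (@le_trans _ _ (N%:R * (9 * (delta / (9 * N%:R))))).
  by rewrite !ler_wpM2l// (le_trans h)// /eta ge_min lexx orbT.
have N0 : N%:R != 0 :> R by rewrite pnatr_eq0.
by rewrite le_eqVlt; apply/orP; left; apply/eqP; move: N0; set c := N%:R => N0; field.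
Qed.

Lemma end_eventually_small (c : R) (v : nat -> 'rV[int]_d) : 0 < c ->
  eventually_small P (fun n => [set w | c * n%:R < esum (wt w) (v n)]).
Proof.
move=> c0 delta /end_small[s0 s00 hs].
exists (Num.bound (s0 / c)) => n nn; split.
  by apply: measurable_gt; exact: measurable_end_sum.
apply: hs; rewrite mulrC -ler_pdivrMr//.
apply: ltW; apply: lt_le_trans (_ : (Num.bound (s0 / c))%:R <= _).
  by apply: archi_boundP; rewrite divr_ge0// ltW.
by rewrite ler_nat.
Qed.

Definition deviates (z : 'rV[int]_d) (eps : R) (n : nat) : set T :=
  [set w | eps < `|passage_time (wt w) 0 (z *+ n) / n%:R - mu z| ].

Lemma deviates_eventually_small z (eps : R) : 0 < eps ->
  eventually_small P (deviates z eps).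
Proof.
move=> eps0 delta delta0.
have /fine_cvgP[_ /cvgrPdist_le /(_ delta delta0)] := mu_time_constant z eps0.
move=> [n0 _ hn0]; exists n0 => n nn; split.
  apply: measurable_gt; apply: measurableT_comp => //.
  apply: measurable_funB; last exact: measurable_cst.
  apply: measurable_funM; last exact: measurable_cst.
  exact: measurable_passage.
have := hn0 n nn; rewrite /= sub0r normrN; apply: le_trans.
exact: ler_norm.
Qed.

(** [crude_hub] at distance J n with n growing; C is chosen before J, which is what makes the bound
    in [mu_lipschitz] linear in J. *)
Lemma hub_eventually_small : exists2 C : R, 0 < C &
  forall (J : nat) (u v : nat -> 'rV[int]_d), (0 < J)%N ->
    (forall n l, `|v n 0 l - u n 0 l| <= (J * n)%N%:Z) ->
    exists2 F, eventually_small P F &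
      forall n w, (0 < n)%N -> ~ F n w -> htime (wt w) (u n) (v n) <= C * (J * n)%:R.
Proof.
have [C [A' [C0 A'0 hC]]] :=
  crude_hub i01 tau_ge0 tau_indep tau_ident p_gt0 tail_decay m_large.
exists C => // J u v J0 uv.
have ex n : exists B, (0 < n)%N -> [/\ measurable B, Pr P B <= A' / (J * n)%:R ^+ p &
      forall w, ~ B w -> htime (wt w) (u n) (v n) <= C * (J * n)%:R].
  have [->|n0] := posnP n; first by exists set0.
  have [|B hB] := hC (J * n)%N (u n) (v n) _ (uv n); first by rewrite muln_gt0 J0.
  by exists B.
have [F hF] := choice ex; exists F; last first.
  by move=> n w n0; have [_ _] := hF n n0; exact.
move=> delta delta0; exists (Num.bound (A' / delta)).+1 => n nn.
have n0 : (0 < n)%N by apply: leq_ltn_trans nn.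
have [mF PF _] := hF n n0; split=> //.
apply: le_trans PF _.
have n0' : 0 < n%:R :> R by rewrite ltr0n.
have h : n%:R <= (J * n)%:R ^+ p :> R.
  rewrite -natrX ler_nat; apply: leq_trans (leq_pmull n J0) _.
  by rewrite -{1}(expn1 (J * n)) leq_pexp2l// muln_gt0 J0.
apply: (@le_trans _ _ (A' / n%:R)).
  by rewrite ler_wpM2l// lef_pV2 ?posrE// (lt_le_trans _ h).
rewrite ler_pdivrMr// mulrC -ler_pdivrMr//.
apply: ltW; apply: lt_le_trans (_ : (Num.bound (A' / delta))%:R <= _).
  by apply: archi_boundP; rewrite divr_ge0// ltW.
by rewrite ler_nat ltnW.
Qed.

Lemma not_deviates z eps n w : (0 < n)%N -> ~ deviates z eps n w ->
  n%:R * (mu z - eps) <= passage_time (wt w) 0 (z *+ n) <= n%:R * (mu z + eps).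
Proof.
move=> n0 /negP; rewrite -leNgt ler_norml => /andP[h1 h2].
have n0' : 0 < n%:R :> R by rewrite ltr0n.
apply/andP; split; rewrite mulrC.
  by rewrite -ler_pdivlMr//; lra.
by rewrite -ler_pdivrMr//; lra.
Qed.

Lemma mu_ge0 z : 0 <= mu z.
Proof.
apply/ler_addgt0Pr => e e_gt0.
have [n [w [n1 nw]]] := eventually_small_outside 1 (deviates_eventually_small z e_gt0).
have /andP[_] := not_deviates n1 nw.
have := passage_time_ge0 (wt_ge0 tau_ge0 w) 0 (z *+ n).
move=> /le_trans/[apply]; rewrite pmulr_rge0// ltr0n//.
Qed.

(** The time to n k z, divided by n, approaches [mu (z *+ k)]; divided by k n, it approaches mu z
    along a subsequence. Both hold at a common sample point. *)
Lemma mu_mul z k : k%:R * mu z <= mu (z *+ k).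
Proof.
have [->|k0] := posnP k; first by rewrite mul0r mu_ge0.
have k0' : 0 < k%:R :> R by rewrite ltr0n.
apply/ler_addgt0Pr => e e_gt0.
pose e' := e / (k%:R + 1).
have e'0 : 0 < e' by rewrite divr_gt0// addr_gt0.
have F1 := deviates_eventually_small (z *+ k) e'0.
have F2 : eventually_small P (fun n => deviates z e' (k * n)).
  move=> delta /(deviates_eventually_small z e'0)[n0 h]; exists n0 => n nn.
  by apply: h; apply: leq_trans nn _; exact: leq_pmull.
have [n [w [n1 /not_orP[nF1 nF2]]]] := eventually_small_outside 1 (eventually_smallU F1 F2).
have n0' : 0 < n%:R :> R by rewrite ltr0n.
have kn : (0 < k * n)%N by rewrite muln_gt0 k0.
have /andP[_ h1] := not_deviates n1 nF1.
have /andP[h2 _] := not_deviates kn nF2.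
rewrite -mulrnA in h1; have := le_trans h2 h1.
rewrite natrM mulrAC [k%:R * _ * _]mulrC ler_pM2l//.
have -> : e = k%:R * e' + e' by rewrite /e'; field; rewrite gt_eqF// addr_gt0.
rewrite mulrBr; lra.
Qed.

(** Reach n a through n b and bound the remaining distance by hubs. Two deviations from the limit
    and two end sums cost e / 4 each, after division by n. *)
Lemma mu_lipschitz : exists2 C : R, 0 < C & forall (J : nat) (a b : 'rV[int]_d), (0 < J)%N ->
  (forall l, `|a 0 l - b 0 l| <= J%:Z) -> mu a <= mu b + C * J%:R.
Proof.
have [C C0 hC] := hub_eventually_small.
exists C => // J a b J0 ab; apply/ler_addgt0Pr => e e_gt0.
have e4 : 0 < e / 4 by rewrite divr_gt0.
have [|F hF hFw] := hC J (fun n => b *+ n) (fun n => a *+ n) J0.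
  move=> n l; rewrite !mulmxnE -mulrnBl normrMn -mulr_natr PoszM natz.
  by rewrite ler_wpM2r.
have G1 := deviates_eventually_small a e4; have G2 := deviates_eventually_small b e4.
have G3 := end_eventually_small (fun n => b *+ n) e4.
have G4 := end_eventually_small (fun n => a *+ n) e4.
have := eventually_small_outside 1
  (eventually_smallU hF (eventually_smallU (eventually_smallU G1 G2) (eventually_smallU G3 G4))).
move=> [n [w [n1 /not_orP[nF /not_orP[/not_orP[n_a n_b] /not_orP[/negP e_b /negP e_a]]]]]].
have n0' : 0 < n%:R :> R by rewrite ltr0n.
have /andP[h1 _] := not_deviates n1 n_a; have /andP[_ h2] := not_deviates n1 n_b.
have h3 := hFw n w n1 nF.
have t0 := wt_ge0 tau_ge0 w.
have h4 := passage_le_hub i0 i1 m (b *+ n) (a *+ n) t0.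
have h5 := passage_time_triangle t0 0 (b *+ n) (a *+ n).
rewrite -!leNgt in e_a e_b; rewrite natrM in h3.
rewrite -(ler_pM2l n0').
have : n%:R * (mu b + C * J%:R + e) =
  n%:R * (mu b + e / 4) + C * (J%:R * n%:R) + e / 4 * n%:R + e / 4 * n%:R + e / 4 * n%:R.
  by field.
move=> ->; rewrite mulrBr in h1; lra.
Qed.

End TimeConstant.

(** * Finite-range approximation of hub times *)

Section LocalApproximation.
Context (R : realType) (d : nat) (i0 i1 : 'I_d).
Variable m : nat.
Implicit Types (t : edge d -> R).
Local Notation unit i := (delta_mx 0 i : 'rV[int]_d).
Local Notation u1 := (unit i1).
Local Notation htime := (@hub_time R d i0 i1 m).
Local Notation scost := (@step_cost R d i0 i1 m).
Local Notation hindex := (@hub_index R d i0 i1 m).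

Definition path_enum (k : nat) : seq (edge d) := odflt [::] (unpickle k).

Lemma path_enum_surj g : exists k, path_enum k = g.
Proof. by exists (pickle g); rewrite /path_enum pickleK. Qed.

Variables (W : 'rV[int]_d) (y : 'I_d -> 'rV[int]_d) (n : 'I_d -> nat).

Definition step_sum t : R :=
  \sum_(i < d) \sum_(l < n i) scost i (shift (y i + unit i *+ l) t).

(** Lists that do not join the two hubs are replaced by the step sum, so every term remains an upper
    bound for the hub time. *)
Definition path_or_sum (a b k : nat) t : R :=
  if connects (u1 *+ a) (path_enum k) (W + u1 *+ b)
  then path_time t (path_enum k) else step_sum t.

(* Decreases to [hub_time t 0 W] as k grows, but depends on finitely many weights
   only. *)
Definition local_time (k : nat) t : R :=
  Num.min (step_sum t)
    (minf (fun j => path_or_sum (hindex t) (hindex (shift W t)) j t) k).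

Lemma local_step_sum : local_fun step_sum.
Proof.
apply: local_fun_sum => i; apply: local_fun_sum => l.
by apply: local_fun_shift; exact: local_step_cost.
Qed.

(** With both hub heights frozen the minimum is local; the random heights are put back one at a time
    through [local_fun_argf]. *)
Lemma local_local_time k : local_fun (local_time k).
Proof.
have lG a b : local_fun (fun t => minf (fun j => path_or_sum a b j t) k).
  apply: local_fun_minf => j; rewrite /path_or_sum; case: connects.
    exact: local_fun_path.
  exact: local_step_sum.
have lH a : local_fun (fun t => minf (fun j => path_or_sum a (hindex (shift W t)) j t) k).
  apply: (local_fun_argf (F := fun j t => cost i0 i1 m j (shift W t))
    (G := fun b t => minf (fun j => path_or_sum a b j t) k)) => // j.
  by apply: (local_fun_shift W); exact: local_fun_path.
apply: local_fun_min; first exact: local_step_sum.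
apply: (local_fun_argf (F := cost i0 i1 m)
  (G := fun a t => minf (fun j => path_or_sum a (hindex (shift W t)) j t) k)) => // j.
exact: local_fun_path.
Qed.

Lemma local_time_le k t : local_time k t <= step_sum t.
Proof. by rewrite /local_time ge_min lexx. Qed.

Lemma local_time_nonincr k l t : (k <= l)%N -> local_time l t <= local_time k t.
Proof.
move=> kl; rewrite /local_time le_min ge_min lexx /= ge_min; apply/orP; right.
rewrite -[minf _ k]f_argf; set j := argf _ k.
have jl : (j < l.+1)%N by rewrite ltnS (leq_trans (argf_le _ _)).
by rewrite leNgt; apply/negP => /lt_minfP /(_ j jl); rewrite ltxx.
Qed.

Hypothesis hy : forall t, (forall e, 0 <= t e) -> htime t 0 W <= step_sum t.

Section Nonneg.
Variable t : edge d -> R.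
Hypothesis t0 : forall e, 0 <= t e.

Lemma hub_time_le_local k : htime t 0 W <= local_time k t.
Proof.
rewrite /local_time le_min hy//= -f_argf /path_or_sum; case: ifP => c; last exact: hy.
rewrite /hub_time /hub add0r shift0; exact: (passage_time_le t0).
Qed.

Lemma local_time_ge0 k : 0 <= local_time k t.
Proof. by apply: le_trans (hub_time_le_local k); exact: passage_time_ge0. Qed.

Lemma local_time_cvg h : htime t 0 W < h -> exists k, local_time k t < h.
Proof.
rewrite /hub_time /hub add0r shift0 => /(passage_time_ltP t0)[g cg gh].
have [k kg] := path_enum_surj g; exists k.
rewrite /local_time gt_min; apply/orP; right.
apply: le_lt_trans gh; rewrite leNgt; apply/negP => /lt_minfP /(_ k (ltnSn k)).
by rewrite /path_or_sum kg cg ltxx.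
Qed.

End Nonneg.

Lemma hub_time_chain k t : (forall e, 0 <= t e) -> forall j,
  htime t 0 (W *+ j) <= \sum_(i < j) local_time k (shift (0 + W *+ i) t).
Proof.
move=> t0; elim=> [|j IH]; first by rewrite mulr0n hub_time0// big_ord0.
rewrite big_ord_recr /= add0r.
apply: le_trans (hub_time_triangle _ _ _ 0 (W *+ j) _ t0) _.
apply: lerD => //.
have := hub_time_le_local (shift_ge0 (W *+ j) t0) k.
by rewrite hub_time_shift add0r mulrS.
Qed.

End LocalApproximation.

(** * Mean of the approximated hub time *)

Section LinearGrowth.
Context (R : realType) (d : nat) (i0 i1 : 'I_d).
Hypothesis i01 : i0 != i1.
Context (dT : measure_display) (T : measurableType dT) (P : probability T R).
Variable tau : edge d -> {RV P >-> R}.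
Hypothesis tau_ge0 : forall e w, 0 <= tau e w.
Hypothesis tau_indep : mutually_independent tau.
Hypothesis tau_ident : forall e e', same_distribution (tau e) (tau e').
Local Notation wt := (weights tau).
Variable mu : 'rV[int]_d -> R.
Hypothesis mu_time_constant : forall z, is_time_constant tau z (mu z).
Variable e0 : edge d.
Variables m p : nat.
Hypothesis p_gt0 : (0 < p)%N.
Local Notation N := m.+1.
Local Notation unit i := (delta_mx 0 i : 'rV[int]_d).
Local Notation ptail := (tail tau e0).
Local Notation htime := (@hub_time R d i0 i1 m).
Local Notation scost := (@step_cost R d i0 i1 m).
Local Notation esum := (@end_sum R d i1 m).
Variables A beta : R.
Hypothesis beta_gt0 : 0 < beta.
Hypothesis tail_decay : forall s : R, 0 < s -> ptail s <= A * s `^ (- beta).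
Hypothesis m_large : (2 * p).+1%:R <= beta * N%:R.

Let mom_scost i : mom P (2 * p) (fun w => scost i (wt w)).
Proof. exact: (mom_step_cost i01 tau_ge0 tau_indep tau_ident tail_decay m_large). Qed.

Lemma mom_step_sum y n : mom P (2 * p) (fun w => step_sum i0 i1 m y n (wt w)).
Proof.
apply: mom_sum => i; apply: mom_sum => l.
exact: (mom_shift tau_indep tau_ident _ (local_step_cost R i0 i1 m i) (mom_scost i)).
Qed.

(* A step sum is uniformly integrable after division by its number of steps:
   on a small event B, use [x <= x^2 / kappa + kappa]. *)
Lemma le_step_sum (kappa h : R) (f : T -> R) (y : 'I_d -> 'rV[int]_d) (n : 'I_d -> nat)
    (B : set T) : 0 < kappa -> 0 <= h -> measurable B -> integ P f ->
  (forall w, f w <= step_sum i0 i1 m y n (wt w)) -> (forall w, ~ B w -> f w <= h) ->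
  Ex P f <= h + (\sum_i n i)%:R *
    ((\sum_i Ex P (fun w => scost i (wt w) ^+ 2)) / kappa + kappa * Pr P B).
Proof.
move=> k0 h0 mB If fs fh.
pose X (i : 'I_d) (l : nat) w := scost i (shift (y i + unit i *+ l) (wt w)).
have lsq i : local_fun (fun t => scost i t ^+ 2).
  by have [r lr] := local_step_cost R i0 i1 m i; exists r; exact: measurable_funX.
have p2 : (2 <= 2 * p)%N by lia.
have Isq i : integ P (fun w => scost i (wt w) ^+ 2) by exact: momX (mom_scost i) p2.
have IX i l : integ P (fun w => X i l w ^+ 2) /\
    Ex P (fun w => X i l w ^+ 2) = Ex P (fun w => scost i (wt w) ^+ 2).
  have [r lr] := lsq i.
  exact: (integ_shift tau_indep tau_ident (y i + unit i *+ l) lr (Isq i)).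
have IB := integ_indic P mB.
pose Y i l w := kappa^-1 * X i l w ^+ 2 + kappa * (\1_B w : R).
have IY i l : integ P (Y i l).
  by apply: integD; apply: integZ => //; have [] := IX i l.
have EY i l : Ex P (Y i l) = (Ex P (fun w => scost i (wt w) ^+ 2)) / kappa + kappa * Pr P B.
  have [I1 E1] := IX i l.
  by rewrite ExD ?ExZ ?E1 ?Ex_indic ?[_^-1 * _]mulrC//; exact: integZ.
have Y0 i l w : 0 <= Y i l w.
  by rewrite addr_ge0// mulr_ge0 ?invr_ge0 ?sqr_ge0 ?(ltW k0)// indicE.
have IS : integ P (fun w => \sum_i \sum_(l < n i) Y i l w).
  by apply: integ_sum => i; apply: integ_sum => l.
have amgm (x : R) : x <= kappa^-1 * x ^+ 2 + kappa.
  by rewrite -(ler_pM2l k0) mulrDr mulVKf ?gt_eqF//; nra.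
apply: (@le_trans _ _ (Ex P (fun w => h + \sum_i \sum_(l < n i) Y i l w))).
  apply: le_Ex => //; first by apply: integD => //; exact: integ_cst.
  move=> w; have [Bw|nBw] := pselect (B w); last first.
    by apply: le_trans (fh w nBw) _; rewrite lerDl !sumr_ge0// => i _; rewrite sumr_ge0.
  apply: le_trans (fs w) _; rewrite ler_wpDl//.
  by apply: ler_sum => i _; apply: ler_sum => l _; rewrite /Y indicE mem_set// mulr1; exact: amgm.
rewrite ExD//; last exact: integ_cst.
rewrite Ex_cst lerD2l Ex_sum; last by move=> i; apply: integ_sum => l.
rewrite natr_sum mulr_suml; apply: ler_sum => i _.
rewrite Ex_sum//; under eq_bigr do rewrite EY.
rewrite sumr_const card_ord -[leLHS]mulr_natl; apply: ler_wpM2l => //; rewrite lerD2r.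
rewrite ler_wpM2r ?invr_ge0 ?(ltW k0)// (bigD1 i)//= lerDl sumr_ge0// => j _.
by apply: Ex_ge0 => w; exact: sqr_ge0.
Qed.

(** The weak law gives n (mu v + 1/8) and the ends add n / 32 each, so the hub time is below h = n
    (mu v + 1/4) off a rare event. Continuity from below then provides k for which the local time is
    at most h with probability at least 1 - delta, and uniform integrability bounds the rest by n /
    4. *)
Lemma local_mean (v : 'rV[int]_d) : exists n k y (c : 'I_d -> nat),
  [/\ (0 < n)%N,
      forall t : edge d -> R, (forall e, 0 <= t e) ->
        htime t 0 (v *+ n) <= step_sum i0 i1 m y c t &
      Ex P (fun w => local_time i0 i1 m (v *+ n) y c k (wt w)) <= n%:R * (mu v + 2^-1)].
Proof.
pose L := (\sum_(i < d) `|v 0%R i|)%N.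
pose S := \sum_i Ex P (fun w => scost i (wt w) ^+ 2).
have S0 : 0 <= S by apply: sumr_ge0 => i _; apply: Ex_ge0 => w; exact: sqr_ge0.
(* A step sum for the displacement n v has n L terms, and [kappa] and [delta] involve L but not n.
   The two errors L S / kappa and L kappa delta are each at most 1/8. *)
pose kappa : R := 8 * (L%:R * S + 1).
have kappa0 : 0 < kappa by rewrite mulr_gt0// ltr_wpDl// mulr_ge0.
pose delta : R := (8 * (L%:R * kappa + 1))^-1.
have delta0 : 0 < delta by rewrite invr_gt0 mulr_gt0// ltr_wpDl// mulr_ge0// ltW.
have delta2 : 0 < delta / 2 by rewrite divr_gt0.
have mu0 := mu_ge0 tau_ge0 mu_time_constant.
have e32 : (0 : R) < 32^-1 by rewrite invr_gt0.
have e8 : (0 : R) < 8^-1 by rewrite invr_gt0.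
have F1 := deviates_eventually_small tau_ge0 mu_time_constant v e8.
have F2 := end_eventually_small i01 tau_ge0 tau_indep tau_ident m beta_gt0 tail_decay
  (fun=> 0) e32.
have F3 := end_eventually_small i01 tau_ge0 tau_indep tau_ident m beta_gt0 tail_decay
  (fun n => v *+ n) e32.
have [n0 hn0] := eventually_smallU F1 (eventually_smallU F2 F3) delta2.
pose n := n0.+1.
have [] := hn0 n (leqnSn n0).
set F := _ `|` _ => mF PF.
have n0' : 0 < n%:R :> R by rewrite ltr0n.
pose h : R := n%:R * (mu v + 4^-1).
have h0 : 0 <= h by rewrite mulr_ge0// addr_ge0.
have Fh w : ~ F w -> htime (wt w) 0 (v *+ n) < h.
  move=> /not_orP[nd /not_orP[/negP + /negP]]; rewrite -!leNgt => h1 h2.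
  have /andP[_ h3] := not_deviates (ltn0Sn n0) nd.
  have h4 := hub_le_passage i0 i1 m 0 (v *+ n) (wt_ge0 tau_ge0 w).
  rewrite /h; apply: le_lt_trans h4 _.
  rewrite -/n in h3; move: h1 h2 h3 => /=; rewrite !mulrDr; lra.
have [y hy] := @hub_path R d i0 i1 i01 m 0 (v *+ n).
pose c (i : 'I_d) := `|(v *+ n)%R 0%R i - (0%R : 'rV[int]_d) 0%R i|%N.
have cE : (\sum_i c i = n * L)%N.
  rewrite /L big_distrr /=; apply: eq_bigr => i _.
  by rewrite /c mxE subr0 mulmxnE -mulr_natr abszM natz mulnC.
pose Z k w := local_time i0 i1 m (v *+ n) y c k (wt w).
have mZ k : measurable_fun setT (Z k).
  have [r lr] := local_local_time R i0 i1 m (v *+ n) y c k.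
  exact: (measurable_local tau lr).
have Z0 k w : 0 <= Z k w by exact: (local_time_ge0 hy (wt_ge0 tau_ge0 w)).
pose G k := [set w | Z k w <= h].
have mG k : measurable (G k).
  have -> : G k = ~` [set w | h < Z k w].
    by apply/seteqP; split=> w; rewrite /G /= leNgt => /negP.
  exact/measurableC/measurable_gt.
have ndG : nondecreasing_seq G.
  move=> k l kl; apply/subsetPset => w; rewrite /G /=.
  by apply: le_trans; exact: local_time_nonincr.
have mUG : measurable (\bigcup_k G k) by exact: bigcupT_measurable.
have PUG : 1 - delta / 2 <= Pr P (\bigcup_k G k).
  apply: (@le_trans _ _ (Pr P (~` F))); first by rewrite PrC// lerD2l lerN2.
  apply: le_Pr => //; first exact: measurableC.
  move=> w /Fh /(local_time_cvg y c (wt_ge0 tau_ge0 w)) [k hk].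
  by exists k => //; exact/ltW/hk.
have [k hk] : exists k, 1 - delta <= Pr P (G k).
  have : (fun k => P (G k)) @ \oo --> (Pr P (\bigcup_k G k))%:E.
    by rewrite -PrE//; exact: nondecreasing_cvg_mu.
  move=> /fine_cvgP[_ /cvgrPdist_le /(_ _ delta2)] [k _ hk]; exists k.
  have := hk k (leqnn k); rewrite /= -/(Pr P (G k)) ler_norml => /andP[_ hk']; lra.
exists n, k, y, c; split => //.
have p2 : (0 < 2 * p)%N by rewrite muln_gt0.
have mZk : mom P (2 * p) (Z k).
  apply: (mom_dom (mZ k) (mom_step_sum y c)) => w.
  by rewrite !ger0_norm ?(le_trans (Z0 k w))// local_time_le.
have IZ : integ P (Z k) := mom_integ mZk p2.
have mC := measurableC (mG k).
apply: le_trans (le_step_sum kappa0 h0 mC IZ _ _) _.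
- by move=> w; exact: local_time_le.
- by move=> w; rewrite /G /= => /contrapT.
rewrite PrC// cE -/S natrM /h.
have h1 : L%:R * S / kappa <= 8^-1.
  rewrite ler_pdivrMr// /kappa mulrA mulVf ?mul1r ?lerDl//.
have h2 : L%:R * kappa * (1 - Pr P (G k)) <= 8^-1.
  apply: (@le_trans _ _ (L%:R * kappa * delta)).
    apply: ler_wpM2l; first by rewrite mulr_ge0// ltW.
    by rewrite lerBlDl -lerBlDr.
  rewrite /delta ler_pdivrMr; last by rewrite mulr_gt0// ltr_wpDl// mulr_ge0// ltW.
  by rewrite mulKf ?pnatr_eq0// lerDl.
have -> : n%:R * (mu v + 4^-1) + n%:R * L%:R * (S / kappa + kappa * (1 - Pr P (G k))) =
  n%:R * (mu v + 4^-1 + (L%:R * S / kappa + L%:R * kappa * (1 - Pr P (G k)))) by ring.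
by rewrite ler_pM2l//; lra.
Qed.

End LinearGrowth.

(** * Upper tail *)

Section FineScale.
Context (R : realType) (d : nat) (i0 i1 : 'I_d).
Hypothesis i01 : i0 != i1.
Context (dT : measure_display) (T : measurableType dT) (P : probability T R).
Variable tau : edge d -> {RV P >-> R}.
Hypothesis tau_ge0 : forall e w, 0 <= tau e w.
Hypothesis tau_indep : mutually_independent tau.
Hypothesis tau_ident : forall e e', same_distribution (tau e) (tau e').
Local Notation wt := (weights tau).
Variable mu : 'rV[int]_d -> R.
Hypothesis mu_time_constant : forall z, is_time_constant tau z (mu z).
Variable e0 : edge d.
Variables m p : nat.
Hypothesis p_gt0 : (0 < p)%N.
Local Notation N := m.+1.
Local Notation ptail := (tail tau e0).
Local Notation htime := (@hub_time R d i0 i1 m).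
Local Notation esum := (@end_sum R d i1 m).
Variables A beta : R.
Hypothesis beta_gt0 : 0 < beta.
Hypothesis tail_decay : forall s : R, 0 < s -> ptail s <= A * s `^ (- beta).
Hypothesis m_large : (2 * p).+1%:R <= beta * N%:R.

(** The exceptional set is only required to contain the failures of Phi, so Phi itself need not
    define a measurable event. *)
Definition holds_whp (k : nat) (A' : R) (Phi : T -> Prop) : Prop :=
  exists B, [/\ measurable B, Pr P B <= A' / k%:R ^+ p & forall w, ~ B w -> Phi w].

Lemma holds_whp_trivial (k : nat) (A' : R) Phi : (0 < k)%N -> k%:R ^+ p <= A' ->
  holds_whp k A' Phi.
Proof.
move=> k0 kA; exists setT; split => //.
  by rewrite PrT ler_pdivlMr ?exprn_gt0 ?ltr0n// mul1r.
by move=> w /(_ I).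
Qed.

Lemma holds_whp_weaken (k : nat) (a b : R) Phi : a <= b -> holds_whp k a Phi ->
  holds_whp k b Phi.
Proof.
move=> ab [B [mB PB h]]; exists B; split=> //; apply: le_trans PB _.
by rewrite ler_wpM2r// invr_ge0 exprn_ge0.
Qed.

(** With k = k' n + remainder, k' shifted local times reach (k' n) v: their means cost k (mu v +
    1/2) and their fluctuation k / 4. The remainder is covered by the crude bound within the last k
    / 4. The case v = 0 is separate because concentration needs a nonzero translation. *)
Lemma fine_linear (v : 'rV[int]_d) : exists2 A' : R, 0 <= A' &
  forall k : nat, (0 < k)%N ->
    holds_whp k A' (fun w => htime (wt w) 0 (v *+ k) <= k%:R * (mu v + 1)).
Proof.
have mu0 := mu_ge0 tau_ge0 mu_time_constant v.
have [->|v0] := eqVneq v 0.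
  exists 0 => // k _; exists set0; split => //; first by rewrite Pr0 mul0r.
  move=> w _; rewrite mul0rn hub_time0; last exact: wt_ge0.
  by rewrite mulr_ge0// addr_ge0// (mu_ge0 tau_ge0 mu_time_constant).
have [n [k1 [y [c [n0 hy hZ]]]]] := local_mean i01 tau_ge0 tau_indep tau_ident
  mu_time_constant p_gt0 beta_gt0 tail_decay m_large v.
set W := v *+ n in hy hZ.
have W0 : W != 0.
  apply: contraNneq v0 => W0; apply/eqP/rowP => l; have := congr1 (fun M : 'rV_d => M 0 l) W0.
  rewrite /W mulmxnE !mxE => /eqP; rewrite -mulr_natr mulf_eq0 => /orP[/eqP//|].
  by rewrite pnatr_eq0 => /eqP nn; rewrite nn in n0.
pose Z (t : edge d -> R) := local_time i0 i1 m W y c k1 t.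
have lZ : local_fun Z by exact: local_local_time.
have Z0 w : 0 <= Z (wt w) by exact: (local_time_ge0 hy (wt_ge0 tau_ge0 w)).
have mZ : mom P (2 * p) (fun w => Z (wt w)).
  have [r lr] := lZ.
  apply: (mom_dom (measurable_local tau lr)
    (mom_step_sum i01 tau_ge0 tau_indep tau_ident tail_decay m_large y c)) => w.
  by rewrite !ger0_norm ?(le_trans (Z0 w))// local_time_le.
have [C C_ge0 hC] := concentration tau_indep tau_ident lZ W0 p_gt0 mZ.
have [C0 [A0 [C0_gt0 A0_ge0 hJ]]] :=
  crude_hub i01 tau_ge0 tau_indep tau_ident p_gt0 tail_decay m_large.
have [r hr] := norm_coord_bound v.
(* From this threshold on, J below is at least n r and at least k / (8 C0). For smaller k the
   constant makes the bound at least 1. The factor 32 in the constant is 2 times 4^2, from k' + 1 <=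
   2 k and the deviation k / 4. *)
pose k0 : nat := (Num.bound (8 * C0 * (n * r).+1%:R))%N.
exists (k0%:R ^+ p + (C * 32 ^+ p + A0 * (8 * C0) ^+ p)).
  by rewrite !addr_ge0 ?mulr_ge0 ?exprn_ge0// mulr_ge0// ltW.
move=> k k_gt0; have k_gt0' : 0 < k%:R :> R by rewrite ltr0n.
have [kk0|k0k] := ltnP k k0.
  apply: holds_whp_trivial => //.
  rewrite (@le_trans _ _ (k0%:R ^+ p))//.
    by rewrite lerXn2r ?nnegrE// ler_nat ltnW.
  by rewrite lerDl !addr_ge0 ?mulr_ge0 ?exprn_ge0// mulr_ge0// ltW.
apply: (@holds_whp_weaken _ (C * 32 ^+ p + A0 * (8 * C0) ^+ p)).
  by rewrite lerDr exprn_ge0.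
have hk : 8 * C0 * (n * r).+1%:R <= k%:R.
  apply: (@le_trans _ _ k0%:R); last by rewrite ler_nat.
  by apply/ltW/archi_boundP; rewrite !mulr_ge0// ltW.
(* The remaining distance is at most n r, yet J is taken proportional to k: the crude bound then
   fails with probability O(k^(-p)) and still costs at most k / 4. *)
pose J := (Num.trunc (k%:R / (4 * C0))).
have C4 : 0 < 4 * C0 by rewrite mulr_gt0.
have q0 : 0 <= k%:R / (4 * C0) by rewrite divr_ge0// ltW.
have /andP[J1 J2] : J%:R <= k%:R / (4 * C0) < J.+1%:R by exact: truncn_itv.
have q8 : 2 * (n * r).+1%:R <= k%:R / (4 * C0).
  rewrite ler_pdivlMr//; apply: le_trans hk.
  by rewrite le_eqVlt; apply/orP; left; apply/eqP; ring.
have nr1 : 1 <= (n * r).+1%:R :> R by rewrite ler1n.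
have Jn : (n * r <= J)%N.
  rewrite -ltnS -(ltr_nat R); apply: le_lt_trans J2.
  apply: le_trans q8; rewrite -[(n * r).+1%:R]natr1.
  by have := ler0n R (n * r); move: (n * r)%:R => x; lra.
have J8 : k%:R / (8 * C0) <= J%:R.
  have -> : k%:R / (8 * C0) = k%:R / (4 * C0) / 2 by field; rewrite gt_eqF.
  rewrite -[J.+1%:R]natr1 in J2; lra.
have J0 : (0 < J)%N.
  by rewrite -(ltr_nat R); apply: lt_le_trans J8; rewrite divr_gt0// mulr_gt0.
pose k' := (k %/ n)%N.
have kE : k = (k' * n + k %% n)%N := divn_eq k n.
have kn : (k %% n < n)%N by rewrite ltn_mod.
have [|B2 [mB2 PB2 hB2]] := hJ J (v *+ (n * k')) (v *+ k) J0.
  move=> l; rewrite !mulmxnE; move: (hr l); set a := v 0 l => ha.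
  have -> : a *+ k - a *+ (n * k') = a *+ (k %% n).
    by rewrite {1}kE mulrnDr [(k' * n)%N]mulnC addrAC subrr add0r.
  rewrite normrMn -mulr_natr natz; apply: (@le_trans _ _ (r%:Z * n%:Z)).
    by apply: ler_pM => //; rewrite lez_nat ltnW.
  by rewrite -PoszM lez_nat mulnC.
have s0 : 0 < k%:R / 4 :> R by rewrite divr_gt0.
pose B1 := [set w | k'%:R * Ex P (fun w => Z (wt w)) + k%:R / 4 <
                  \sum_(i < k') Z (shift (0 + W *+ i) (wt w))].
have mB1 : measurable B1.
  have [r' lr] := lZ.
  apply: measurable_gt; apply: measurable_sum => i.
  exact: (measurable_local_shift tau _ lr).
have PB1 : Pr P B1 <= C * 32 ^+ p / k%:R ^+ p.
  apply: le_trans (hC 0 k' _ s0) _.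
  rewrite -!mulrA ler_wpM2l// ler_pdivrMr ?exprn_gt0//.
  have -> : 32 ^+ p / k%:R ^+ p * (k%:R / 4) ^+ (2 * p) = (2 * k%:R) ^+ p :> R.
    by rewrite exprM -exprVn -!exprMn; congr (_ ^+ p); field; rewrite gt_eqF.
  rewrite lerXn2r ?nnegrE ?mulr_ge0// -natrM ler_nat.
  by rewrite mul2n -addnn -add1n leq_add// leq_div.
exists (B1 `|` B2); split; first exact: measurableU.
  apply: le_trans (PrU _ mB1 mB2) _; rewrite mulrDl; apply: lerD => //.
  apply: le_trans PB2 _; rewrite -mulrA ler_wpM2l//.
  have kJ : k%:R <= 8 * C0 * J%:R by rewrite mulrC -ler_pdivrMr// mulr_gt0.
  rewrite ler_pdivlMr ?exprn_gt0// mulrC ler_pdivrMr ?exprn_gt0 ?ltr0n//.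
  by rewrite -exprMn lerXn2r ?nnegrE ?mulr_ge0// ltW.
move=> w /not_orP[/negP]; rewrite -leNgt => h1 /hB2 h2.
have t0 := wt_ge0 tau_ge0 w.
apply: le_trans (hub_time_triangle i0 i1 m 0 (v *+ (n * k')) (v *+ k) t0) _.
have h3 := hub_time_chain hy k1 t0 k'.
rewrite /W -mulrnA in h3.
have h4 : k'%:R * Ex P (fun w => Z (wt w)) <= k%:R * (mu v + 2^-1).
  apply: (@le_trans _ _ (k'%:R * (n%:R * (mu v + 2^-1)))); first by rewrite ler_wpM2l.
  rewrite mulrA -natrM ler_wpM2r ?addr_ge0// ler_nat.
  by rewrite [leqRHS]kE leq_addr.
have h5 : C0 * J%:R <= k%:R / 4.
  have : C0 * J%:R <= C0 * (k%:R / (4 * C0)) by rewrite ler_wpM2l// ltW.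
  have -> : C0 * (k%:R / (4 * C0)) = k%:R / 4 by field; rewrite gt_eqF.
  by [].
have := le_trans h3 h1; rewrite !mulrDr in h4 *; lra.
Qed.

End FineScale.

(** The sum of F over the finite box is the bound; the box is parametrised by vectors of ordinals
    shifted by r. *)
Lemma finite_box_bound (R : realType) (d r : nat) (F : 'rV[int]_d -> R) :
  (forall v, 0 <= F v) -> exists2 A' : R, 0 <= A' &
    forall v : 'rV[int]_d, (forall l, `|v 0 l| <= r%:Z) -> F v <= A'.
Proof.
move=> F0.
pose conv (s : 'rV['I_(2 * r).+1]_d) : 'rV[int]_d := \row_l ((s 0 l : nat)%:Z - r%:Z).
exists (\sum_s F (conv s)); first exact: sumr_ge0.
move=> v hv.
pose s : 'rV['I_(2 * r).+1]_d := \row_l inord `|(v 0%R l + r%:Z)%R|%N.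
have -> : v = conv s.
  apply/rowP => l; rewrite !mxE; have := hv l; move: (v 0 l) => a ha.
  by rewrite inordK; lia.
by rewrite (bigD1 s)//= lerDl sumr_ge0.
Qed.

Section UpperTail.
Context (R : realType) (d : nat) (i0 i1 : 'I_d).
Hypothesis i01 : i0 != i1.
Context (dT : measure_display) (T : measurableType dT) (P : probability T R).
Variable tau : edge d -> {RV P >-> R}.
Hypothesis tau_ge0 : forall e w, 0 <= tau e w.
Hypothesis tau_indep : mutually_independent tau.
Hypothesis tau_ident : forall e e', same_distribution (tau e) (tau e').
Local Notation wt := (weights tau).
Variable mu : 'rV[int]_d -> R.
Hypothesis mu_time_constant : forall z, is_time_constant tau z (mu z).
Variable e0 : edge d.
Variables m p : nat.
Hypothesis p_gt0 : (0 < p)%N.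
Local Notation N := m.+1.
Local Notation ptail := (tail tau e0).
Local Notation htime := (@hub_time R d i0 i1 m).
Local Notation esum := (@end_sum R d i1 m).
Variables A beta : R.
Hypothesis beta_gt0 : 0 < beta.
Hypothesis tail_decay : forall s : R, 0 < s -> ptail s <= A * s `^ (- beta).
Hypothesis m_large : (2 * p).+1%:R <= beta * N%:R.

Lemma fine_uniform (r : nat) : exists2 A' : R, 0 <= A' &
  forall v : 'rV[int]_d, (forall l, `|v 0 l| <= r%:Z) -> forall k : nat, (0 < k)%N ->
    holds_whp P p k A' (fun w => htime (wt w) 0 (v *+ k) <= k%:R * (mu v + 1)).
Proof.
have ex (v : 'rV[int]_d) : exists a : R, 0 <= a /\ forall k : nat, (0 < k)%N ->
    holds_whp P p k a (fun w => htime (wt w) 0 (v *+ k) <= k%:R * (mu v + 1)).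
  have [a a0 ha] := fine_linear i01 tau_ge0 tau_indep tau_ident mu_time_constant p_gt0
    beta_gt0 tail_decay m_large v.
  by exists a.
have [F hF] := choice ex.
have [A' A'0 hA'] := @finite_box_bound R d r F (fun v => (hF v).1).
exists A' => // v hv k k0; apply: holds_whp_weaken (hA' v hv) _.
exact: (hF v).2.
Qed.

Lemma upper_tail (eps q : R) : 0 < eps -> 0 <= q -> q <= p%:R ->
  exists M : R, 0 < M /\ forall (z : 'rV[int]_d) (x : R), (l1norm z)%:~R <= x -> 0 < x ->
    Pr P [set w | eps * x < passage_time (wt w) 0 z - mu z] <=
    M * ptail (x / M) ^+ (2 * d) + M / x `^ q.
Proof.
move=> eps0 q0 qp.
have [C0 [A2 [C0_gt0 A2_ge0 hJ]]] :=
  crude_hub i01 tau_ge0 tau_indep tau_ident p_gt0 tail_decay m_large.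
have [C1 C1_gt0 hL] := mu_lipschitz i01 tau_ge0 tau_indep tau_ident mu_time_constant
  p_gt0 beta_gt0 tail_decay m_large.
(* Errors per unit of k: 1 from [fine_uniform], C0 for the remainder z - k v, and C1 from comparing
   the time constants at k v and z. As k <= eta x, they total at most eps x / 2; the two end sums
   take eps x / 4 each. *)
pose K := 1 + C0 + C1.
have K0 : 0 < K by rewrite !addr_gt0.
pose eta := Num.min 1 (eps / (2 * K)).
have eta0 : 0 < eta by rewrite lt_min ltr01 divr_gt0// mulr_gt0.
have eta1 : eta <= 1 by rewrite ge_min lexx.
have etaK : K * eta <= eps / 2.
  have : eta <= eps / (2 * K) by rewrite ge_min lexx orbT.
  rewrite -(ler_pM2l K0) => /le_trans; apply.
  by rewrite le_eqVlt; apply/orP; left; apply/eqP; field; rewrite gt_eqF.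
(* For x >= x0 one has eta x >= 2, so truncating eta x loses at most half of it: k >= 1 and x <= x0
   k. *)
pose x0 := 2 / eta.
have x00 : 0 < x0 by rewrite divr_gt0.
have x02 : 2 <= x0 by rewrite ler_pdivlMr// ler_piMr.
(* Bounds the coordinates of v, since each of them times k is at most x + k in absolute value. *)
pose r := Num.bound (x0 + 1).
have hr : x0 + 1 < r%:R by apply: archi_boundP; rewrite addr_ge0// ltW.
have [A1 A1_ge0 hA1] := fine_uniform r.
(* 36 N is 4 times 9 N: a quarter of eps x for each end, shared among N neighbour steps of at most
   nine edges. [M2] counts the two ends, [M3] converts k^(-p) into x^(-q), and [M4] makes the bound
   trivial for x < x0. *)
pose M1 : R := 36 * N%:R / eps.
pose M2 : R := 2 * N%:R * 9 ^+ (2 * d).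
pose M3 := (A1 + A2) * x0 ^+ p.
have M1_gt0 : 0 < M1 by rewrite divr_gt0// mulr_gt0.
have M2_ge0 : 0 <= M2 by rewrite !mulr_ge0.
have M3_ge0 : 0 <= M3 by rewrite mulr_ge0 ?addr_ge0// exprn_ge0// ltW.
pose M4 := x0 `^ q.
have M4_ge0 : 0 <= M4 by exact: powR_ge0.
pose M := M1 + M2 + M3 + M4.
have M0 : 0 < M by rewrite /M -!addrA ltr_pwDl// !addr_ge0.
exists M; split=> // z x zx x_gt0.
have xq0 : 0 < x `^ q by exact: powR_gt0.
have mE : measurable [set w | eps * x < passage_time (wt w) 0 z - mu z].
  apply: measurable_gt; apply: measurable_funB; last exact: measurable_cst.
  exact: measurable_passage.
have first_ge0 : 0 <= M * ptail (x / M) ^+ (2 * d).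
  by rewrite mulr_ge0 ?(ltW M0)// exprn_ge0// tail_ge0.
have [xx0|x0x] := ltP x x0.
  apply: le_trans (Pr_le1 P mE) _; rewrite ler_wpDl// ler_pdivlMr// mul1r.
  apply: (@le_trans _ _ M4); last by rewrite /M lerDr !addr_ge0// ltW.
  by apply: ge0_ler_powR; rewrite ?nnegrE// ltW.
have x1 : 1 <= x by lra.
have ex2 : 2 <= eta * x by rewrite mulrC -ler_pdivrMr.
pose k := Num.trunc (eta * x).
have /andP[k1 k2] : k%:R <= eta * x < k.+1%:R.
  by apply: truncn_itv; lra.
have kx : x <= x0 * k%:R.
  rewrite -[k.+1%:R]natr1 in k2.
  by rewrite /x0 mulrAC ler_pdivlMr// mulrC; lra.
have k0 : (0 < k)%N by rewrite -(ltr_nat R); rewrite -[k.+1%:R]natr1 in k2; lra.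
have k0' : 0 < k%:R :> R by rewrite ltr0n.
pose v : 'rV[int]_d := \row_l (z 0%R l %/ k)%Z.
have zv l : z 0 l - (v *+ k) 0 l = (z 0%R l %% k)%Z.
  rewrite mulmxnE mxE {1}(divz_eq (z 0 l) k) -mulr_natr natz.
  by rewrite addrAC subrr add0r.
have k0z : (k%:Z != 0) by rewrite eqz_nat -lt0n.
have modk l : `|z 0 l - (v *+ k) 0 l| <= k%:Z.
  by rewrite zv ger0_norm ?modz_ge0// ltW// ltz_pmod.
have vr l : `|v 0 l| <= r%:Z.
  have zl : `|z 0 l|%:~R <= x.
    apply: le_trans zx; rewrite ler_int /l1norm (bigD1 l)//= lerDl.
    by apply: sumr_ge0.
  have h : `|v 0 l| * k%:Z <= `|z 0 l| + k%:Z.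
    have := modk l; rewrite mulmxnE -mulr_natr natz => h.
    have -> : `|v 0 l| * k%:Z = `|v 0 l * k%:Z| by rewrite normrM.
    have -> : v 0 l * k%:Z = z 0 l - (z 0 l - v 0 l * k%:Z) by ring.
    by apply: le_trans (ler_normB _ _) _; rewrite lerD2l.
  rewrite -(ler_int R); apply: le_trans (ltW hr).
  rewrite -(ler_pM2r k0').
  move: h; rewrite -(ler_int R) intrM intrD => h.
  apply: (le_trans h); rewrite mulrDl mul1r.
  by apply: lerD => //; exact: le_trans zl kx.
have [B1 [mB1 PB1 hB1]] := hA1 v vr k k0.
have [B2 [mB2 PB2 hB2]] := hJ k (v *+ k) z k0 modk.
have s0 : 0 <= eps * x / 4 by rewrite divr_ge0// mulr_ge0// ltW.
pose E y := [set w | eps * x / 4 < esum (wt w) y].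
have mEy y : measurable (E y) by apply: measurable_gt; exact: measurable_end_sum.
have PE y : Pr P (E y) <= N%:R * 9 ^+ (2 * d) * ptail (x / M) ^+ (2 * d).
  apply: le_trans (end_tail i01 tau_ge0 tau_indep tau_ident e0 m y s0) _.
  rewrite -[leRHS]mulrA -[X in _ <= _ * X]exprMn ler_wpM2l//.
  have h : ptail (eps * x / 4 / (9 * N)%:R) <= ptail (x / M).
    apply: tail_le.
    have -> : eps * x / 4 / (9 * N)%:R = x / M1.
      have N0 : N%:R != 0 :> R by rewrite pnatr_eq0.
      rewrite /M1 natrM; move: N0; set c := N%:R => N0; field.
      by rewrite gt_eqF//=.
    rewrite ler_wpM2l ?(ltW x_gt0)// lef_pV2 ?posrE//.
    by rewrite /M -!addrA lerDl !addr_ge0.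
  by rewrite lerXn2r ?nnegrE ?mulr_ge0 ?tail_ge0// ler_wpM2l.
apply: (@le_trans _ _ (Pr P ((B1 `|` B2) `|` (E 0 `|` E z)))).
  apply: le_Pr => //; first by do !apply: measurableU.
  move=> w /= big; apply: contrapT.
  move=> /not_orP[/not_orP[/hB1 h1 /hB2 h2] /not_orP[/negP + /negP]].
  rewrite -!leNgt => h3 h4.
  have t0 := wt_ge0 tau_ge0 w.
  have h5 := passage_le_hub i0 i1 m 0 z t0.
  have h6 := hub_time_triangle i0 i1 m 0 (v *+ k) z t0.
  have h7 := mu_mul tau_ge0 mu_time_constant v k.
  have h8 : mu (v *+ k) <= mu z + C1 * k%:R.
    by apply: hL => // l; rewrite distrC.
  have h9 : K * k%:R <= eps * x / 2.
    apply: (@le_trans _ _ (K * (eta * x))); first by rewrite ler_wpM2l// ltW.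
    by rewrite mulrA [leRHS]mulrAC ler_wpM2r// ltW.
  rewrite /K !mulrDl mul1r in h9; rewrite mulrDr mulr1 in h1.
  lra.
apply: le_trans (PrU P (measurableU _ _ mB1 mB2) (measurableU _ _ (mEy 0) (mEy z))) _.
rewrite addrC; apply: lerD.
  apply: le_trans (PrU P (mEy 0) (mEy z)) _.
  apply: le_trans (lerD (PE 0) (PE z)) _.
  rewrite -mulrDl ler_wpM2r ?exprn_ge0 ?tail_ge0//.
  have -> : N%:R * 9 ^+ (2 * d) + N%:R * 9 ^+ (2 * d) = M2 by rewrite /M2; ring.
  by rewrite /M -!addrA addrCA lerDl !addr_ge0// ltW.
apply: le_trans (PrU P mB1 mB2) _.
apply: le_trans (lerD PB1 PB2) _; rewrite -mulrDl.
apply: (@le_trans _ _ (M3 / x `^ q)); last first.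
  rewrite ler_wpM2r ?invr_ge0 ?(ltW xq0)//.
  by rewrite /M addrAC lerDr !addr_ge0// ltW.
rewrite /M3 -mulrA ler_wpM2l ?addr_ge0//.
rewrite ler_pdivlMr// mulrC ler_pdivrMr ?exprn_gt0// -exprMn.
apply: (@le_trans _ _ (x ^+ p)); last first.
  by apply: lerXn2r => //; rewrite nnegrE; [exact: ltW|exact: (mulr_ge0 (ltW x00))].
by rewrite -powR_mulrn ?(ltW x_gt0)// ler_powR.
Qed.

End UpperTail.

(** * From the moment of Y to the decay of the edge tail, and conclusion *)

Lemma powR_moment_tail (R : realType) (dU : measure_display) (U : measurableType dU)
    (Q : probability U R) (Y : {RV Q >-> R}) (alpha : R) : 0 < alpha ->
  ('E_Q[fun u => (Y u `^ alpha)%R] < +oo)%E ->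
  exists2 C : R, 0 <= C & forall s : R, 0 < s ->
    Pr Q [set u | s < Y u] <= C * s `^ (- alpha).
Proof.
move=> a0; rewrite unlock => fin.
have mYa : measurable_fun setT (fun u => Y u `^ alpha).
  exact: (measurableT_comp (measurable_powR alpha)).
have IY : integ Q (fun u => Y u `^ alpha).
  apply/integrableP; split; first exact/measurable_EFinP.
  apply: le_lt_trans fin; rewrite le_eqVlt; apply/orP; left; apply/eqP.
  by apply: eq_integral => u _ /=; rewrite ger0_norm// powR_ge0.
exists (Ex Q (fun u => Y u `^ alpha)).
  by apply: Ex_ge0 => u; exact: powR_ge0.
move=> s s0; have sa : 0 < s `^ alpha by exact: powR_gt0.
rewrite powRN ler_pdivlMr// mulrC.
apply: le_trans (markov_ge (s `^ alpha) IY _); last by move=> u; exact: powR_ge0.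
rewrite ler_wpM2l ?powR_ge0//; apply: le_Pr.
- exact: measurable_gt.
- exact: measurable_ge.
- move=> u /= sY; apply: ge0_ler_powR; rewrite ?nnegrE ?ltW//.
  exact: lt_trans sY.
Qed.

Lemma root_tail_decay (R : realType) (f : R -> R) (n : nat) (C alpha : R) :
  (0 < n)%N -> 0 <= C -> (forall s, 0 <= f s) ->
  (forall s : R, 0 < s -> f s ^+ n <= C * s `^ (- alpha)) ->
  forall s : R, 0 < s -> f s <= C `^ n%:R^-1 * s `^ (- (alpha / n%:R)).
Proof.
move=> n0 C0 f0 hf s s0; have n0' : n%:R != 0 :> R by rewrite pnatr_eq0 -lt0n.
have -> : f s = (f s ^+ n) `^ n%:R^-1.
  by rewrite -powR_mulrn// -powRrM mulfV// powRr1.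
apply: le_trans (_ : (C * s `^ (- alpha)) `^ n%:R^-1 <= _).
  apply: ge0_ler_powR; rewrite ?nnegrE ?invr_ge0 ?exprn_ge0 ?mulr_ge0 ?powR_ge0//.
  exact: hf.
by rewrite powRM ?powR_ge0// -powRrM mulNr.
Qed.

Theorem theorem4 (R : realType) (d : nat) (d_ge2 : (2 <= d)%N)
  (dT : measure_display) (T : measurableType dT) (P : probability T R)
  (tau : edge d -> {RV P >-> R})
  (tau_ge0 : forall e w, 0 <= tau e w)
  (tau_indep : mutually_independent tau)
  (tau_ident : forall e e', same_distribution (tau e) (tau e'))
  (mu : 'rV[int]_d -> R)
  (mu_time_constant : forall z, is_time_constant tau z (mu z))
  (dU : measure_display) (U : measurableType dU) (Q : probability U R)
  (X : 'I_(2 * d) -> {RV Q >-> R})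
  (X_indep : mutually_independent X)
  (X_tau : forall i e, same_distribution (X i) (tau e))
  (Y : {RV Q >-> R}) (Y_min : is_minimum X Y)
  (alpha : R) (alpha_gt0 : 0 < alpha)
  (Y_moment : ('E_Q[fun u => (Y u `^ alpha)%R] < +oo)%E)
  (eps : R) (eps_gt0 : 0 < eps) (q : R) (q_ge1 : 1 <= q) :
  exists M : R, 0 < M /\
    forall (z : 'rV[int]_d) (x : R), (l1norm z)%:~R <= x -> 0 < x ->
      (P [set w | (eps * x < passage_time (fun e => tau e w) 0 z - mu z)%R]
       <= M%:E * Q [set u | (x / M < Y u)%R] + (M / x `^ q)%R%:E)%E.
Proof.
have d0 : (0 < 2 * d)%N by rewrite muln_gt0 (ltnW d_ge2).
pose i0 : 'I_d := Ordinal (ltnW d_ge2); pose i1 : 'I_d := Ordinal d_ge2.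
have i01 : i0 != i1 by [].
pose e0 : edge d := (0, i0).
have tailY := minimum_tail e0 X_indep X_tau Y_min.
have [C C0 hC] := powR_moment_tail alpha_gt0 Y_moment.
(* Markov's inequality for Y, transported along [tailY], bounds the power 2d of the edge tail; its
   root gives the exponent alpha / (2d). *)
have decay := root_tail_decay d0 C0 (tail_ge0 tau e0)
  (fun s s0 => eq_ind _ (fun y => y <= C * s `^ (- alpha)) (hC s s0) _ (tailY s)).
pose beta := alpha / (2 * d)%:R.
have beta0 : 0 < beta by rewrite divr_gt0// ltr0n.
have q0 : 0 <= q by exact: le_trans q_ge1.
pose p := Num.bound q.
have qp : q <= p%:R by exact/ltW/archi_boundP.
have p0 : (0 < p)%N.
  by rewrite -(ltr_nat R) (lt_le_trans _ qp)// (lt_le_trans _ q_ge1).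
(* Enough candidates for moments of order 2p: this is where a small alpha is paid for. *)
pose m := Num.bound ((2 * p).+1%:R / beta).
have m_large : (2 * p).+1%:R <= beta * m.+1%:R.
  rewrite mulrC -ler_pdivrMr//; apply: (@le_trans _ _ m%:R).
    by apply/ltW/archi_boundP; rewrite divr_ge0// ltW.
  by rewrite ler_nat.
have [M [M0 hM]] := upper_tail i01 tau_ge0 tau_indep tau_ident mu_time_constant
  p0 beta0 decay m_large eps_gt0 q0 qp.
exists M; split => // z x zx x0.
have mE : measurable
    [set w | eps * x < passage_time (fun e => tau e w) 0 z - mu z].
  apply: measurable_gt; apply: measurable_funB; last exact: measurable_cst.
  exact: (measurable_passage tau_ge0).
rewrite (PrE P mE) (PrE Q (measurable_gt (x / M) (measurable_funP Y))).
by rewrite tailY -EFinM -EFinD lee_fin; exact: hM.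
Qed.
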